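(* Let $\mathcal{P}=\mathcal{P}_{11/20}$ and let $$\Lambda=\{(\alpha,\theta,\phi,\theta',\phi') : \alpha\in[0,2\pi],\ \phi'\in[0,2\pi],\ \phi\in[0,\pi],\ \theta\in[0,\pi/2],\ \theta'\in[0,\pi/2]\}\subset\mathbb{R}^5,$$ equipped with $5$-dimensional Lebesgue measure $\lambda$. There is a measurable set $E\subseteq\Lambda$ with $\lambda(E)\ge 0.88\,\lambda(\Lambda)$ such that no point $(\alpha,\theta,\phi,\theta',\phi')\in E$ is a Rupert passage for $\mathcal{P}_{11/20}$.
   Context: For $a\in\mathbb{R}$, $\mathcal{P}_a\subset\mathbb{R}^3$ is the convex hull of the eight points $p_0=(1,1,1)$, $p_1=(1,-1,-1)$, $p_2=(-1,1,-1)$, $p_3=(-1,-1,1)$, $q_0=(-a,-a,-a)$, $q_1=(-a,a,a)$, $q_2=(a,-a,a)$, $q_3=(a,a,-a)$. For angles $\theta,\phi$, let $M_{\theta,\phi}:\mathbb{R}^3\to\mathbb{R}^2$ be the linear map with matrix $$M_{\theta,\phi}=\begin{pmatrix}-\sin\theta & \cos\theta & 0\\ -\cos\theta\cos\phi & -\sin\theta\cos\phi & \sin\phi\end{pmatrix},$$ and let $R_\alpha$ be counterclockwise rotation of $\mathbb{R}^2$ by angle $\alpha$. For convex polygons $P,Q\subset\mathbb{R}^2$ (convex hulls of finitely many points), say that $P$ fits inside $Q$ if there exist $s>1$ and $t\in\mathbb{R}^2$ with $sP+t\subseteq Q^\circ$, where $Q^\circ$ is the interior of $Q$. A tuple $(\alpha,\theta,\phi,\theta',\phi')$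 is a Rupert passage for a polyhedron $\mathcal{P}$ if $R_\alpha M_{\theta,\phi}\mathcal{P}$ fits inside $M_{\theta',\phi'}\mathcal{P}$. *)

(* Defs.v *)
From HB Require Import structures.
From mathcomp Require Import all_boot all_order all_algebra.
From mathcomp Require Import all_classical all_reals all_analysis.
Set Implicit Arguments. Unset Strict Implicit. Unset Printing Implicit Defensive.
Import Order.TTheory GRing.Theory Num.Theory.
Import numFieldNormedType.Exports.
Local Open Scope classical_set_scope.
Local Open Scope ring_scope.

Section Rupert.
Variable R : realType.

Definition conv {V : lmodType R} (pts : seq V) : set V :=
  [set x | exists w : 'I_(size pts) -> R,
     (forall i, 0 <= w i) /\ \sum_i w i = 1 /\
     x = \sum_i w i *: pts`_i].

Definition pt3 (x y z : R) : 'rV[R]_3 := \row_(i < 3) [:: x; y; z]`_i.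
Definition pt2 (x y : R) : 'rV[R]_2 := \row_(i < 2) [:: x; y]`_i.

Definition Pa (a : R) : set 'rV[R]_3 :=
  conv [:: pt3 1 1 1; pt3 1 (-1) (-1); pt3 (-1) 1 (-1); pt3 (-1) (-1) 1;
           pt3 (-a) (-a) (-a); pt3 (-a) a a; pt3 a (-a) a; pt3 a a (-a)].

Definition Mproj (theta phi : R) (v : 'rV[R]_3) : 'rV[R]_2 :=
  let x := v ord0 0 in
  let y := v ord0 1 in
  let z := v ord0 2%:R in
  pt2 (- sin theta * x + cos theta * y)
      (- cos theta * cos phi * x - sin theta * cos phi * y + sin phi * z).

Definition Rot (alpha : R) (v : 'rV[R]_2) : 'rV[R]_2 :=
  let x := v ord0 0 in
  let y := v ord0 1 in
  pt2 (cos alpha * x - sin alpha * y) (sin alpha * x + cos alpha * y).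

Definition fits_inside (P Q : set 'rV[R]_2) : Prop :=
  exists s : R, 1 < s /\ exists t : 'rV[R]_2,
    (fun p => s *: p + t) @` P `<=` interior Q.

Definition rupert_passage (P : set 'rV[R]_3)
  (alpha theta phi theta' phi' : R) : Prop :=
  fits_inside ((Rot alpha \o Mproj theta phi) @` P) (Mproj theta' phi' @` P).

Definition Lambda : set (R * R * R * R * R) :=
  [set u | let: (alpha, theta, phi, theta', phi') := u in
     [/\ 0 <= alpha <= 2 * pi, 0 <= phi' <= 2 * pi, 0 <= phi <= pi,
         0 <= theta <= pi / 2 & 0 <= theta' <= pi / 2]].

Local Open Scope ereal_scope.
Definition leb5 :=
  (((@lebesgue_measure R \x @lebesgue_measure R) \x @lebesgue_measure R)
     \x @lebesgue_measure R) \x @lebesgue_measure R.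

End Rupert.

(* Main.v *)
From Stdlib Require Import ZArith.
Require Import Defs.
From HB Require Import structures.
From mathcomp Require Import all_boot all_order all_algebra.
From mathcomp Require Import all_classical all_reals all_analysis.
From mathcomp Require Import ssrZ ring lra zify.
Set Implicit Arguments. Unset Strict Implicit. Unset Printing Implicit Defensive.
Import Order.TTheory GRing.Theory Num.Theory.
Import numFieldNormedType.Exports.
Local Open Scope classical_set_scope.
Local Open Scope ring_scope.

(* If the first shadow, rotated, fits inside the second, it is narrower than the
   second one in every direction. In the direction of angle [b] its width is at
   least [2 * diam theta phi b], where [diam] is the largest projection of a
   halved edge of the tetrahedron [p_0 p_1 p_2 p_3]; in the same direction,
   of angle [b + alpha], the width of the second shadow is at most
   [2 * diam theta' phi' (b + alpha)] as soon as this exceeds the distances of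
   the other pairs of vertices. Hence a single [b] with
   [1.344 <= diam theta phi b] and
   [diam theta' phi' (b + alpha) <= diam theta phi b] excludes a passage.
   Let [b] be the direction of the longest projected edge, fixed on each cell of
   [(theta, phi)]. Since [alpha] is uniform and independent of the other angles,
   so is [b + alpha], and the 5-dimensional measure of the good parameters is a
   count of pairs formed by a cell of [(theta, phi)] and a cell of
   [(b + alpha, theta', phi')]. On a grid of mesh [pi / 128] the symmetries of
   [diam] reduce it to 2048 cells of the first kind and 65536 of the second, and
   integer arithmetic finds 88.8 percent of good pairs. *)

(** * Integers as reals *)

(* Locked: unfolding it on a concrete integer would build a unary natural. *)
HB.lock Definition zr (R : realType) (z : Z) : R := (int_of_Z z)%:~R.

Section ZtoR.
Variable R : realType.

Local Notation zr := (@zr R).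

Lemma zr0 : zr Z0 = 0. Proof. by rewrite unlock. Qed.

Lemma zr1 : zr 1 = 1. Proof. by rewrite unlock. Qed.

Lemma zrD x y : zr (Z.add x y) = zr x + zr y.
Proof. by rewrite unlock (rmorphD int_of_Z x y) intrD. Qed.

Lemma zrN x : zr (Z.opp x) = - zr x.
Proof. by rewrite unlock (rmorphN int_of_Z x) intrN. Qed.

Lemma zrB x y : zr (Z.sub x y) = zr x - zr y.
Proof. by rewrite -Z.add_opp_r zrD zrN. Qed.

Lemma zrM x y : zr (Z.mul x y) = zr x * zr y.
Proof. by rewrite unlock (rmorphM int_of_Z x y) intrM. Qed.

Lemma zr_ge0 x : Z.le Z0 x -> 0 <= zr x.
Proof. by case: x => [||p []]// => [|p] _; rewrite unlock ?ler0z. Qed.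

Lemma zr_le x y : Z.le x y -> zr x <= zr y.
Proof. by move=> xy; rewrite -subr_ge0 -zrB zr_ge0//; lia. Qed.

Lemma zr_lt x y : Z.lt x y -> zr x < zr y.
Proof.
move=> xy; have: zr (Z.add x 1) <= zr y by apply: zr_le; lia.
by apply: lt_le_trans; rewrite zrD zr1 ltrDl.
Qed.

Lemma zr_nat n : zr (Z.of_nat n) = n%:R.
Proof. by rewrite unlock -[n%:R]/(n%:Z%:~R); congr intmul; lia. Qed.

Lemma zr_pow2 n : zr (Z.pow 2 (Z.of_nat n)) = 2 ^+ n.
Proof.
elim: n => [|n IH]; first by rewrite expr0 zr1.
by rewrite Nat2Z.inj_succ Z.pow_succ_r ?zrM ?IH ?exprS; [rewrite (zr_nat 2)|lia].
Qed.

Lemma zr_abs x : zr (Z.abs x) = `|zr x|.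
Proof.
have [x0|x0] : Z.le 0 x \/ Z.le x 0 by lia.
  by rewrite Z.abs_eq// ger0_norm// zr_ge0.
rewrite Z.abs_neq// zrN ler0_norm//.
by rewrite -oppr_ge0 -zrN zr_ge0//; lia.
Qed.

Lemma zr_shiftr x n m : Z.le 0 n -> Z.pow 2 n = m ->
  zr (Z.shiftr x n) * zr m <= zr x < (zr (Z.shiftr x n) + 1) * zr m.
Proof.
move=> n0 mE; rewrite Z.shiftr_div_pow2// mE.
have m0 : Z.lt 0 m by rewrite -mE; apply: Z.pow_pos_nonneg.
have := Z.div_mod x m; have := Z.mod_pos_bound x m m0.
set q := Z.div x m => r_lt xE; rewrite -zr1 -zrD -!zrM.
by apply/andP; split; [apply: zr_le|apply: zr_lt]; lia.
Qed.

Lemma zr_sqrt x : Z.le 0 x ->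
  zr (Z.sqrt x) ^+ 2 <= zr x < (zr (Z.sqrt x) + 1) ^+ 2.
Proof.
move=> x0; have [l u] := Z.sqrt_spec x x0.
rewrite -zr1 -zrD !expr2 -!zrM.
by apply/andP; split; [apply: zr_le|apply: zr_lt; rewrite Z.add_1_r].
Qed.

End ZtoR.

(** * A certified table of sines and cosines *)

(* Enclosures are scaled by [2 * m]. *)
Definition half_cos (m : Z) (p : Z * Z) : Z * Z :=
  (Z.sqrt (Z.mul m (Z.add (Z.mul 2 m) p.1)),
   Z.add (Z.sqrt (Z.mul m (Z.add (Z.mul 2 m) p.2))) 1).

(** The sine from the cosine by Pythagoras; the ends of the enclosure are exchanged because the map
    is decreasing. *)
Definition pyth_cofactor (m : Z) (p : Z * Z) : Z * Z :=
  (Z.sqrt (Z.sub (Z.mul (Z.mul 2 m) (Z.mul 2 m)) (Z.mul p.2 p.2)),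
   Z.add (Z.sqrt (Z.sub (Z.mul (Z.mul 2 m) (Z.mul 2 m)) (Z.mul p.1 p.1))) 1).

Lemma cofactor_bounds (F : realFieldType) (T x y a b sl su : F) :
  x ^+ 2 + y ^+ 2 = 1 -> 0 <= T -> 0 <= y -> 0 <= a -> 0 <= su ->
  0 <= sl -> a <= T * x <= b ->
  sl ^+ 2 <= T * T - b * b -> T * T - a * a <= su ^+ 2 -> sl <= T * y <= su.
Proof.
move=> xy T0 y0 a0 su0 sl0 /andP[ax xb] sl2 su2.
have e1 : (T * x) ^+ 2 + (T * y) ^+ 2 = T ^+ 2.
  by rewrite !exprMn -mulrDr xy mulr1.
have Ty0 : 0 <= T * y by rewrite mulr_ge0.
move: ax xb e1 Ty0; set X := T * x; set Y := T * y => ax xb e1 Ty0.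
have X0 : 0 <= X by lra.
by apply/andP; split; rewrite -ler_sqr ?nnegrE//; nra.
Qed.

Section Arc.
Variable R : realType.
Local Notation zr := (@zr R).

Definition enclosed (m : Z) (p : Z * Z) (x : R) : Prop :=
  [/\ Z.le 0 p.1, Z.le p.1 p.2, Z.le p.2 (Z.mul 2 m) & zr p.1 <= 2 * zr m * x <= zr p.2].

(** Half-angle formula: [(2 * m * cos x) ^ 2 = m * (2 * m + 2 * m * cos (2 * x))]. The integer
    square root falls short by less than 1, whence the [+ 1] at the upper end. *)
Lemma half_cosP m p (x : R) : Z.lt 0 m -> 0 <= cos x -> enclosed m p (cos (x *+ 2)) ->
  zr (half_cos m p).1 <= 2 * zr m * cos x <= zr (half_cos m p).2.
Proof.
case: p => l u m0 x0 []/= l0 lu um; rewrite cos_mulr2n => /andP[lc cu].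
have := @zr_sqrt R (Z.mul m (Z.add (Z.mul 2 m) l)) ltac:(nia).
have := @zr_sqrt R (Z.mul m (Z.add (Z.mul 2 m) u)) ltac:(nia).
rewrite !zrM !(zrD, zrM) zr1 (zr_nat R 2).
set a := Z.sqrt _; set b := Z.sqrt _ => /andP[_ bu] /andP[al _].
have b0 : 0 <= zr b by apply/zr_ge0/Z.sqrt_nonneg.
have a0 : 0 <= zr a by apply/zr_ge0/Z.sqrt_nonneg.
have s0 : 0 <= zr m by apply: zr_ge0; lia.
move: cu lc bu al; set y := cos x in x0 *; set s := zr m in s0 * => cu lc bu al.
have {}lc := ler_wpM2l s0 lc; have {}cu := ler_wpM2l s0 cu.
apply/andP; split.
  rewrite -ler_sqr ?nnegrE//; last by rewrite !mulr_ge0.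
  have: s * (2 * s * (y ^+ 2 *+ 2 - 1)) + s * (2 * s) = (2 * s * y) ^+ 2 by ring.
  by lra.
rewrite -ler_sqr ?nnegrE ?addr_ge0//; last by rewrite !mulr_ge0.
nra.
Qed.

Lemma pyth_cofactorP m p (x : R) : Z.lt 0 m -> 0 <= sin x -> enclosed m p (cos x) ->
  zr (pyth_cofactor m p).1 <= 2 * zr m * sin x <= zr (pyth_cofactor m p).2.
Proof.
case: p => l u m0 x0 []/= l0 lu um lcu.
have sq k : Z.le 0 k -> Z.le k (Z.mul 2 m) ->
    Z.le 0 (Z.sub (Z.mul (Z.mul 2 m) (Z.mul 2 m)) (Z.mul k k)).
  by move=> k0 km; apply/Z.le_0_sub/Z.mul_le_mono_nonneg.
have := @zr_sqrt R _ (sq l l0 (Z.le_trans _ _ _ lu um)).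
have := @zr_sqrt R _ (sq u (Z.le_trans _ _ _ l0 lu) um).
rewrite zrD !zrB !zrM zr1 (zr_nat R 2).
set a := Z.sqrt _; set b := Z.sqrt _ => /andP[al _] /andP[_ bu].
have s0 : 0 <= zr m by apply: zr_ge0; lia.
apply: (@cofactor_bounds _ _ (cos x) _ (zr l) (zr u)) => //; rewrite ?cos2Dsin2 ?mulr_ge0//.
- exact: zr_ge0.
- by rewrite addr_ge0//; apply/zr_ge0/Z.sqrt_nonneg.
- by apply/zr_ge0/Z.sqrt_nonneg.
- exact: ltW.
Qed.

End Arc.

Definition S20 : Z := Eval compute in Z.pow 2 20.
Definition S40 : Z := Eval compute in Z.pow 2 40.
Definition S59 : Z := Eval compute in Z.pow 2 59.

(** Starts at [cos (pi / 2) = 0]; six halvings reach [pi / 128]. The working scale is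
    [2 * S59 = 2 ^ 60]; [cos_step] and [sin_step] drop it to [2 ^ 40]. *)
Definition cos_chain (k : nat) := iter k (half_cos S59) (Z0, Z0).
Definition sin_chain := pyth_cofactor S59 (cos_chain 6).
Definition cos_step := Z.shiftr (cos_chain 6).1 20.
Definition sin_step := Z.shiftr sin_chain.1 20.

Definition trig_step (p : Z * Z) : Z * Z :=
  (Z.shiftr (Z.sub (Z.mul p.1 cos_step) (Z.mul p.2 sin_step)) 40,
   Z.shiftr (Z.add (Z.mul p.1 sin_step) (Z.mul p.2 cos_step)) 40).

Section Table.
Variable R : realType.
Local Notation zr := (@zr R).

Definition mesh : R := pi / 128%:R.

Lemma cos_chainP k : (k <= 6)%N ->
  enclosed S59 (cos_chain k) (cos (pi / 2 ^+ k.+1) : R).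
Proof.
have ok : all (fun k => let: p := cos_chain k in
   [&& Z.leb 0 p.1, Z.leb p.1 p.2 & Z.leb p.2 (Z.mul 2 S59)]) (iota 0 7).
  by vm_compute.
elim: k => [_|k IH k6].
  by split=> //=; rewrite expr1 cos_pihalf mulr0 zr0 lexx.
have /(allP ok) : k.+1 \in iota 0 7 by rewrite mem_iota.
case/and3P => /Z.leb_le ? /Z.leb_le ? /Z.leb_le ?; split=> //.
apply: half_cosP; first exact/Z.ltb_lt.
  apply: cos_ge0_pihalf; have := @pi_gt0 R => p0.
  have pk : 1 <= 2 ^+ k.+1 :> R by apply: exprn_ege1; lra.
  rewrite exprS invfM mulrA.
  have h0 : 0 <= pi / 2 :> R by lra.
  apply/andP; split.
    by rewrite (@le_trans _ _ 0)//; [lra|rewrite divr_ge0// (le_trans _ pk)].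
  by rewrite ler_pdivrMr ?(lt_le_trans _ pk)// ler_peMr.
rewrite (_ : _ *+ 2 = pi / 2 ^+ k.+1); first exact: (IH (ltnW k6)).
by rewrite -mulr_natr [in LHS]exprS; field; rewrite expf_neq0 ?pnatr_eq0.
Qed.

Lemma mesh_gt0 : 0 < mesh. Proof. by rewrite divr_gt0 ?pi_gt0. Qed.

Lemma mesh_pow2 : mesh = pi / 2 ^+ 7.
Proof. by rewrite /mesh -natrX. Qed.

(** Since [2 * S59 = S40 * S20], dropping 20 bits passes to the scale [S40], where the enclosure
    spans at most two units. *)
Lemma shift_enclosure z lo hi (x : R) : Z.leb (Z.mul z S20) lo ->
  Z.leb hi (Z.mul (Z.add z 2) S20) -> zr lo <= 2 * zr S59 * x <= zr hi ->
  `|zr z - zr S40 * x| <= 2.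
Proof.
move=> /Z.leb_le/(zr_le R) + /Z.leb_le/(zr_le R).
have sE : Z.mul 2 S59 = Z.mul S40 S20 by [].
have p0 : 0 < zr S20 by rewrite -(zr0 R); apply: zr_lt.
rewrite -(zr_nat R 2) -(zrM R 2) sE !zrM zrD (zr_nat R 2).
move: p0; set t := zr S20; set S := zr S40; set a := zr z => p0 la ub /andP[l u].
have := le_trans la l; have := le_trans u ub.
rewrite [S * t]mulrC -!mulrA [(_ + _) * t]mulrC ler_pM2l// [a * t]mulrC ler_pM2l//.
by move=> ? ?; rewrite ler_norml; apply/andP; split; lra.
Qed.

Lemma cos_stepP : `|zr cos_step - zr S40 * cos mesh| <= 2.
Proof.
have [_ _ _] := cos_chainP (leqnn 6); rewrite -mesh_pow2.
by apply: shift_enclosure; vm_compute.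
Qed.

Lemma sin_stepP : `|zr sin_step - zr S40 * sin mesh| <= 2.
Proof.
have s0 : 0 <= sin mesh.
  apply: sin_ge0_pi; rewrite ltW ?mesh_gt0//= /mesh ler_pdivrMr//.
  by rewrite ler_peMr ?pi_ge0 ?ler1n.
have := cos_chainP (leqnn 6); rewrite -mesh_pow2 => enc.
by apply: shift_enclosure (pyth_cofactorP _ s0 enc); vm_compute.
Qed.

End Table.

(** * Error propagation along the table of sines and cosines *)

(** One rotation by an inexact step: the previous error is amplified by at most [(|C| + |N|) / S],
    the errors of [C] and [N] contribute 2 each, and the final floor contributes 1. *)
Lemma rotation_error (F : realFieldType) (S C N a b c s x y x' e : F) :
  1000 <= S -> `|a| <= 1 -> `|b| <= 1 -> `|C - S * c| <= 2 -> `|N - S * s| <= 2 ->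
  `|C| + `|N| <= 103%:R / 100%:R * S ->
  `|x - S * a| <= e -> `|y - S * b| <= e ->
  x' * S <= x * C - y * N < (x' + 1) * S ->
  `|x' - S * (a * c - b * s)| <= 103%:R / 100%:R * e + 5%:R.
Proof.
move=> S0 a1 b1 dC dN CN dx dy /andP[l u].
have e0 : 0 <= e by apply: le_trans dx.
have S1 : 0 < S by lra.
have h : `|x * C - y * N - S * S * (a * c - b * s)| <= 103%:R / 100%:R * e * S + 4%:R * S.
  have -> : x * C - y * N - S * S * (a * c - b * s) =
    (x - S * a) * C + S * a * (C - S * c) - ((y - S * b) * N + S * b * (N - S * s)) by ring.
  apply: le_trans (ler_normB _ _) _.
  have n1 : `|(x - S * a) * C| <= e * `|C| by rewrite normrM ler_wpM2r.
  have n2 : `|(y - S * b) * N| <= e * `|N| by rewrite normrM ler_wpM2r.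
  have n3 : `|S * a * (C - S * c)| <= S * 1 * 2.
    by rewrite !normrM (gtr0_norm S1); apply: ler_pM; rewrite ?ler_pM2l// mulr_ge0 ?normr_ge0// ltW.
  have n4 : `|S * b * (N - S * s)| <= S * 1 * 2.
    by rewrite !normrM (gtr0_norm S1); apply: ler_pM; rewrite ?ler_pM2l// mulr_ge0 ?normr_ge0// ltW.
  have := ler_normD ((x - S * a) * C) (S * a * (C - S * c)).
  have := ler_normD ((y - S * b) * N) (S * b * (N - S * s)).
  have := ler_wpM2l e0 CN; rewrite mulrDr mulrA [103%:R / _ * e]mulrC.
  lra.
move: h; rewrite !ler_norml => /andP[h1 h2]; apply/andP; split; rewrite -(ler_pM2r S1); lra.
Qed.

(** Seven squarings, each rounded upwards to a short fraction. *)
Lemma growth_bound (F : realFieldType) : (103%:R / 100%:R) ^+ 128 <= 45%:R :> F.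
Proof.
set q : F := _ / _.
have sq n (u v : F) : q ^+ n <= u -> u ^+ 2 <= v -> q ^+ n.*2 <= v.
  move=> h1; apply: le_trans; rewrite -addnn exprD -expr2 ler_sqr ?nnegrE ?exprn_ge0//.
    by rewrite /q; lra.
  by apply: le_trans h1; rewrite exprn_ge0// /q; lra.
have p0 : q ^+ 1 <= 103%:R / 100%:R by rewrite expr1.
have p1 := sq _ _ (1061%:R / 1000%:R) p0 ltac:(lra).
have p2 := sq _ _ (1126%:R / 1000%:R) p1 ltac:(lra).
have p3 := sq _ _ (1268%:R / 1000%:R) p2 ltac:(lra).
have p4 := sq _ _ (1608%:R / 1000%:R) p3 ltac:(lra).
have p5 := sq _ _ (2586%:R / 1000%:R) p4 ltac:(lra).
have p6 := sq _ _ (669%:R / 100%:R) p5 ltac:(lra).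
have p7 := sq _ _ (45%:R) p6 ltac:(lra).
exact: p7.
Qed.

Lemma rounding_error (F : realFieldType) (z r x t h : F) :
  1000 * 1000 <= t -> t = 2 * h -> `|z - x * t| <= (9 * 1000) ->
  r * t <= z + h < (r + 1) * t -> `|r - x| <= 51%:R / 100%:R.
Proof.
move=> t0 th; rewrite !ler_norml => /andP[h1 h2] /andP[l u].
have s0 : 0 < t by lra.
apply/andP; split; rewrite -(ler_pM2r s0).
  by rewrite mulrBl; move: l u h1 h2; rewrite mulrDl; set a := r * t; set b := x * t; lra.
by rewrite mulrBl; move: l u h1 h2; rewrite mulrDl; set a := r * t; set b := x * t; lra.
Qed.

Definition S14 : Z := Eval compute in Z.pow 2 14.
Definition S25 : Z := Eval compute in Z.pow 2 25.
Definition S26 : Z := Eval compute in Z.pow 2 26.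

(** Adding [S25], half of [2 ^ 26], before the shift rounds to the nearest integer at scale
    [S14]. *)
Definition trig_round (p : Z * Z) : Z * Z :=
  (Z.shiftr (Z.add p.1 S25) 26, Z.shiftr (Z.add p.2 S25) 26).

Definition trig_table : seq (Z * Z) :=
  map trig_round (traject trig_step (S40, Z0) 129).

Definition tg (k : nat) : Z * Z := nth (Z0, Z0) trig_table k.

Section TrigTable.
Variable R : realType.
Local Notation zr := (@zr R).
Local Notation mesh := (mesh R).

Lemma step_norm : `|zr cos_step| + `|zr sin_step| <= 103%:R / 100%:R * zr S40.
Proof.
rewrite -!zr_abs -zrD mulrAC ler_pdivlMr// -(zr_nat R 103) -(zr_nat R 100) -!zrM.
by apply: zr_le; apply/Z.leb_le; vm_compute.
Qed.

Lemma S40_ge : 1000 <= zr S40.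
Proof. by rewrite -(zr_nat R 1000); apply: zr_le; apply/Z.leb_le; vm_compute. Qed.

(** A majorant of the recursion [e' = 103/100 * e + 5] started at 0; [200] exceeds [5 / (3/100)]. *)
Let err (k : nat) : R := 200%:R * ((103%:R / 100%:R) ^+ k - 1).

Lemma trig_iterP k : let: p := iter k trig_step (S40, Z0) in
  `|zr p.1 - zr S40 * cos (k%:R * mesh)| <= err k /\
  `|zr p.2 - zr S40 * sin (k%:R * mesh)| <= err k.
Proof.
elim: k => [|k [IHc IHs]].
  by rewrite /err expr0 subrr mulr0 mul0r cos0 sin0 mulr1 mulr0 zr0 !subrr normr0.
rewrite iterS; set p := iter k _ _ in IHc IHs *.
have errS : 103%:R / 100%:R * err k + 5%:R <= err k.+1.
  by rewrite /err exprS; lra.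
have sE : Z.pow 2 40 = S40 by [].
rewrite -addn1 natrD mulrDl mul1r cosD sinD addn1; split; apply: le_trans errS.
  apply: rotation_error; [exact: S40_ge|exact: cos_max|exact: sin_max|
    exact: cos_stepP|exact: sin_stepP|exact: step_norm|exact: IHc|exact: IHs|].
  rewrite -(zrM R p.1 cos_step) -(zrM R p.2 sin_step) -zrB; exact: (@zr_shiftr R _ 40 S40).
(* The sine formula is put in the shape of the cosine one, with the two step values exchanged and
   the sine negated, so that [rotation_error] applies again. *)
have -> : sin (k%:R * mesh) * cos mesh + cos (k%:R * mesh) * sin mesh =
  cos (k%:R * mesh) * sin mesh - (- sin (k%:R * mesh)) * cos mesh by ring.
have zN : zr p.1 * zr sin_step + zr p.2 * zr cos_step =
  zr p.1 * zr sin_step - (- zr p.2) * zr cos_step by ring.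
apply: (@rotation_error _ _ (zr sin_step) (zr cos_step) _ _ _ _ (zr p.1) (- zr p.2));
  [exact: S40_ge|exact: cos_max|by rewrite normrN sin_max|
   exact: sin_stepP|exact: cos_stepP|by rewrite addrC step_norm|exact: IHc|
   by rewrite mulrN -opprD normrN|].
by rewrite -zN -(zrM R p.1 sin_step) -(zrM R p.2 cos_step) -zrD; exact: (@zr_shiftr R _ 40 S40).
Qed.

Lemma trig_roundP z (x : R) (k : nat) : (k <= 128)%N ->
  `|zr z - zr S40 * x| <= err k ->
  `|zr (Z.shiftr (Z.add z S25) 26) - zr S14 * x| <= 51%:R / 100%:R.
Proof.
move=> k128 h.
have sE : Z.pow 2 26 = S26 by [].
have lu := @zr_shiftr R (Z.add z S25) 26 S26 ltac:(by []) sE.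
have s40 : zr S40 = zr S14 * zr S26 by rewrite -zrM.
have s26 : zr S26 = 2 * zr S25 by rewrite -(zr_nat R 2) -zrM.
have big : 1000%:R * 1000%:R <= zr S26.
  by rewrite -(zr_nat R 1000) -zrM; apply: zr_le; apply/Z.leb_le; vm_compute.
(* By [growth_bound], [200 * (45 - 1) = 8800]. *)
have e9 : err k <= (9 * 1000).
  rewrite /err; have := @growth_bound R; have : (103%:R / 100%:R) ^+ k <= (103%:R / 100%:R) ^+ 128 :> R.
    by apply: ler_weXn2l => //; lra.
  lra.
apply: (@rounding_error _ (zr z) _ _ _ _ big s26); last by rewrite -zrD lu.
by rewrite mulrAC -s40 (le_trans h).
Qed.

Lemma tgP k : (k <= 128)%N ->
  `|zr (tg k).1 - zr S14 * cos (k%:R * mesh)| <= 51%:R / 100%:R /\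
  `|zr (tg k).2 - zr S14 * sin (k%:R * mesh)| <= 51%:R / 100%:R.
Proof.
move=> k128; rewrite /tg (nth_map (S40, Z0)) ?size_traject// nth_traject//.
by have [hc hs] := trig_iterP k; split; apply: (trig_roundP k128).
Qed.

End TrigTable.

(** * Functions affine in the cosine and the sine, on an arc *)

Lemma sin_sum_le (F : realFieldType) (su cu sv cv : F) : 0 <= su -> 0 <= sv ->
  cu <= 1 -> cv <= 1 -> su * cv + cu * sv <= sv + su.
Proof. by move=> *; nra. Qed.

Lemma half_sum (F : realFieldType) (s c s' c' : F) : 0 <= s -> 0 <= c -> c' <= 1 ->
  (s * c' - c * s' + (s * c' + c * s')) * c <= s * c + c * s.
Proof. move=> s0 c0 c1; have : 0 <= (1 - c') * (s * c) by rewrite !mulr_ge0 ?subr_ge0. lra. Qed.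

Lemma arc_cos_id (F : fieldType) (cx sx cu su cd sd : F) : sd != 0 -> cd ^+2 + sd ^+2 = 1 ->
   cx * cu - sx * su = (sd * cu - cd * su) / sd * cx + su / sd * (cx * cd - sx * sd).
Proof. by move=> *; field. Qed.

Lemma arc_sin_id (F : fieldType) (cx sx cu su cd sd : F) : sd != 0 -> cd ^+2 + sd ^+2 = 1 ->
   sx * cu + cx * su = (sd * cu - cd * su) / sd * sx + su / sd * (sx * cd + cx * sd).
Proof. by move=> *; field. Qed.

Section Arcs.
Variable R : realType.

(** A point of the arc, expanded in the basis of its endpoints: with [u = t - x] and [v = y - t] the
    coefficients are [sin v / sin d] and [sin u / sin d]. Their sum is
    [cos ((u - v) / 2) / cos (d / 2)], at least 1 because the arc lies beyond its chord. *)
Lemma arc_combination (x y t : R) (d := y - x) : x <= t <= y -> 0 < d < pi ->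
  exists l m : R, [/\ 0 <= l, 0 <= m, 1 <= l + m, (l + m) * cos (d / 2) <= 1 &
    cos t = l * cos x + m * cos y /\ sin t = l * sin x + m * sin y].
Proof.
move=> /andP[xt ty] /andP[d0 dpi].
pose u := t - x; pose v := y - t.
have duv : d = u + v by rewrite /d /u /v; lra.
have u0 : 0 <= u by rewrite subr_ge0.
have v0 : 0 <= v by rewrite subr_ge0.
have sd : 0 < sin d by apply: sin_gt0_pi; rewrite d0.
have sv : 0 <= sin v by apply: sin_ge0_pi; rewrite v0/=; rewrite duv in dpi; lra.
have su : 0 <= sin u by apply: sin_ge0_pi; rewrite u0/=; rewrite duv in dpi; lra.
have cd2 : 0 < cos (d / 2) by apply: cos_gt0_pihalf; apply/andP; split; lra.
have sd2 : 0 < sin (d / 2) by apply: sin_gt0_pi; apply/andP; split; lra.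
exists (sin v / sin d), (sin u / sin d); split.
- by rewrite divr_ge0// ltW.
- by rewrite divr_ge0// ltW.
- rewrite -mulrDl ler_pdivlMr// mul1r duv sinD.
  exact: sin_sum_le (cos_le1 _) (cos_le1 _).
- rewrite -mulrDl mulrAC ler_pdivrMr// mul1r.
  have eu : u = d / 2 + (u - v) / 2 by rewrite duv; field.
  have ev : v = d / 2 - (u - v) / 2 by rewrite duv; field.
  have ed : d = d / 2 + d / 2 by field.
  rewrite {1}ev {2}eu [X in _ <= sin X]ed sinB !sinD.
  exact: half_sum (ltW sd2) (ltW cd2) (cos_le1 _).
have vE : v = d - u by rewrite duv addrAC subrr add0r.
have tE : t = x + u by rewrite /u; lra.
have yE : y = x + d by rewrite /d; lra.
clearbody d u v; rewrite tE yE vE sinB !cosD !sinD.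
have sd0 : sin d != 0 by rewrite gt_eqF.
by split; [apply: arc_cos_id|apply: arc_sin_id] => //; exact: cos2Dsin2.
Qed.

(** With the coefficients of [arc_combination], the value at [t] is
    [l * G0 + m * G1 - (l + m - 1) * C], and the excess [l + m - 1] is at most [e] because [1 + e]
    bounds the secant of half the arc. *)
Lemma arc_upper (A B C x y t a c e : R) : x <= t <= y -> 0 < y - x < pi ->
  0 <= e -> 1 <= (1 + e) * cos ((y - x) / 2) ->
  `|A * cos x + B * sin x + C| <= a -> `|A * cos y + B * sin y + C| <= a ->
  `|C| <= c -> `|A * cos t + B * sin t + C| <= a + e * (a + c).
Proof.
move=> xty yx e0 ec g0 g1 Cc.
have [l [m [l0 m0 lm1 lmc [-> ->]]]] := arc_combination xty yx.
have lme : l + m - 1 <= e.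
  have cd : 0 < cos ((y - x) / 2).
    by apply: cos_gt0_pihalf; case/andP: yx => ? ?; apply/andP; split; lra.
  by rewrite lerBlDl -(ler_pM2r cd) (le_trans lmc).
have a0 : 0 <= a by apply: le_trans g0.
set G0 := _ + C in g0; set G1 := _ + C in g1.
have -> : A * (l * cos x + m * cos y) + B * (l * sin x + m * sin y) + C =
  l * G0 + m * G1 - (l + m - 1) * C by rewrite /G0 /G1; ring.
apply: le_trans (ler_normB _ _) _.
rewrite normrM (ger0_norm (_ : 0 <= l + m - 1)) ?subr_ge0//.
have : `|l * G0 + m * G1| <= (l + m) * a.
  apply: le_trans (ler_normD _ _) _.
  by rewrite !normrM (ger0_norm l0) (ger0_norm m0) mulrDl lerD// ler_wpM2l.
have : (l + m - 1) * `|C| <= e * c by rewrite ler_pM// subr_ge0.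
have : (l + m - 1) * a <= e * a by rewrite ler_wpM2r.
by rewrite mulrDr mulrBl mul1r; lra.
Qed.

(** As [l + m >= 1] and [a >= 0], the combination of the end values stays above [a]; only the
    constant term can lose. *)
Lemma arc_lower (A B C x y t a c e : R) : x <= t <= y -> 0 < y - x < pi ->
  0 <= e -> 1 <= (1 + e) * cos ((y - x) / 2) ->
  0 <= a -> a <= A * cos x + B * sin x + C -> a <= A * cos y + B * sin y + C ->
  `|C| <= c -> a - e * c <= A * cos t + B * sin t + C.
Proof.
move=> xty yx e0 ec a0 g0 g1 Cc.
have [l [m [l0 m0 lm1 lmc [-> ->]]]] := arc_combination xty yx.
have lme : l + m - 1 <= e.
  have cd : 0 < cos ((y - x) / 2).
    by apply: cos_gt0_pihalf; case/andP: yx => ? ?; apply/andP; split; lra.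
  by rewrite lerBlDl -(ler_pM2r cd) (le_trans lmc).
set G0 := _ + C in g0; set G1 := _ + C in g1.
have -> : A * (l * cos x + m * cos y) + B * (l * sin x + m * sin y) + C =
  l * G0 + m * G1 - (l + m - 1) * C by rewrite /G0 /G1; ring.
have : (l + m - 1) * `|C| <= e * c by rewrite ler_pM// subr_ge0.
have : (l + m - 1) * C <= (l + m - 1) * `|C|.
  by rewrite ler_wpM2l ?subr_ge0// ler_norm.
have : 0 <= (l + m - 1) * a by rewrite mulr_ge0// subr_ge0.
have := ler_wpM2l l0 g0; have := ler_wpM2l m0 g1.
by rewrite mulrBl mul1r mulrDl; lra.
Qed.

End Arcs.

(** * Widths of the shadows *)

Lemma le_of_sqr (F : realDomainType) (a c : F) : 0 <= c -> a ^+ 2 <= c ^+ 2 -> a <= c.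
Proof.
move=> c0 ac; have [//|ca] := leP a c.
have : 0 < (a - c) * (a + c).
  by rewrite mulr_gt0 ?subr_gt0// (lt_le_trans (le_lt_trans c0 ca))// lerDl.
by rewrite -subr_sqr subr_gt0 ltNge ac.
Qed.

Section Direction.
Variable R : realType.
Implicit Types (t p b : R) (e : R * R * R).

(* The vector [M^T (cos b, sin b)], up to the sign of its first coordinate. *)
Definition dirx t p b := cos b * sin t + sin b * cos p * cos t.
Definition diry t p b := cos b * cos t - sin b * cos p * sin t.
Definition dirz t p b : R := sin b * sin p.

(* The halved edges of the tetrahedron [p_0 p_1 p_2 p_3]. *)
Definition edges : seq (R * R * R) :=
  [:: (1, 1, 0); (1, -1, 0); (1, 0, 1); (1, 0, -1); (0, 1, 1); (0, 1, -1)].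

Definition lin e t p b := e.1.1 * dirx t p b + e.1.2 * diry t p b + e.2 * dirz t p b.

Definition in_cube e : Prop := [/\ `|e.1.1| <= 1, `|e.1.2| <= 1 & `|e.2| <= 1].

Lemma edges_in_cube e : e \in edges -> in_cube e.
Proof.
rewrite !inE.
by rewrite /in_cube; do ![case/orP]; move/eqP->; rewrite /= ?normrN ?normr0 ?normr1.
Qed.

Lemma abs_sin_cos t : `|sin t| + `|cos t| <= 1415%:R / 1000%:R.
Proof.
have := cos2Dsin2 t; rewrite -[cos t ^+ 2]real_normK ?num_real//.
rewrite -[sin t ^+ 2]real_normK ?num_real//.
have := normr_ge0 (sin t); have := normr_ge0 (cos t).
set x := `|sin t|; set y := `|cos t| => y0 x0 xy.
apply: le_of_sqr; first by lra.
by have := sqr_ge0 (x - y); rewrite sqrrB sqrrD; lra.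
Qed.

(** This and the next two lemmas exhibit [lin] as affine in the cosine and sine of each angle
    separately, which is the form required by the arc lemmas. *)
Lemma lin_theta e t p b : lin e t p b =
  (e.1.1 * (sin b * cos p) + e.1.2 * cos b) * cos t +
  (e.1.1 * cos b - e.1.2 * (sin b * cos p)) * sin t + e.2 * (sin b * sin p).
Proof. by rewrite /lin /dirx /diry /dirz; ring. Qed.

Lemma lin_phi e t p b : lin e t p b =
  sin b * (e.1.1 * cos t - e.1.2 * sin t) * cos p + e.2 * sin b * sin p +
  cos b * (e.1.1 * sin t + e.1.2 * cos t).
Proof. by rewrite /lin /dirx /diry /dirz; ring. Qed.

Lemma lin_beta e t p b : lin e t p b =
  (e.1.1 * sin t + e.1.2 * cos t) * cos b +
  (e.1.1 * cos p * cos t - e.1.2 * cos p * sin t + e.2 * sin p) * sin b + 0.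
Proof. by rewrite /lin /dirx /diry /dirz; ring. Qed.

Lemma theta_const e p b : in_cube e -> `|e.2 * (sin b * sin p)| <= 1.
Proof.
by move=> [_ _ e3]; rewrite !normrM !mulr_ile1 ?mulr_ge0 ?sin_max.
Qed.

Lemma phi_const e t b : in_cube e ->
  `|cos b * (e.1.1 * sin t + e.1.2 * cos t)| <= 1415%:R / 1000%:R.
Proof.
move=> [e1 e2 _]; apply: le_trans (abs_sin_cos t).
rewrite normrM; apply: le_trans (ler_piMl (normr_ge0 _) (cos_max _)) _.
by apply: le_trans (ler_normD _ _) _; rewrite !normrM lerD// ler_piMl.
Qed.

(** [arc_upper] is applied to one angle at a time, from the eight corners to edges, faces and
    interior. The constant terms are at most 1 for [t], [1415/1000 > sqrt 2] for [p], and 0 for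
    [b]. *)
Lemma box_upper e (t0 t1 p0 p1 b0 b1 et ep eb a : R) :
  in_cube e -> 0 < t1 - t0 < pi -> 0 < p1 - p0 < pi -> 0 < b1 - b0 < pi ->
  0 <= et -> 0 <= ep -> 0 <= eb ->
  1 <= (1 + et) * cos ((t1 - t0) / 2) -> 1 <= (1 + ep) * cos ((p1 - p0) / 2) ->
  1 <= (1 + eb) * cos ((b1 - b0) / 2) ->
  (forall t p b, t \in [:: t0; t1] -> p \in [:: p0; p1] -> b \in [:: b0; b1] ->
     `|lin e t p b| <= a) ->
  let a1 := a + et * (a + 1) in
  let a2 := a1 + ep * (a1 + 1415%:R / 1000%:R) in
  forall t p b, t0 <= t <= t1 -> p0 <= p <= p1 -> b0 <= b <= b1 ->
    `|lin e t p b| <= a2 + eb * a2.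
Proof.
move=> ee dt dp db et0 ep0 eb0 ct cp cb H a1 a2 t p b tt pp bb.
have i0 (x y : R) : x \in [:: x; y] by rewrite !inE eqxx.
have i1 (x y : R) : y \in [:: x; y] by rewrite !inE eqxx orbT.
have H1 p' b' : p' \in [:: p0; p1] -> b' \in [:: b0; b1] -> `|lin e t p' b'| <= a1.
  move=> p'i b'i; rewrite lin_theta; apply: (arc_upper tt dt et0 ct).
  - by rewrite -lin_theta H.
  - by rewrite -lin_theta H.
  - exact: theta_const.
have H2 b' : b' \in [:: b0; b1] -> `|lin e t p b'| <= a2.
  move=> b'i; rewrite lin_phi; apply: (arc_upper pp dp ep0 cp).
  - by rewrite -lin_phi H1.
  - by rewrite -lin_phi H1.
  - exact: phi_const.
rewrite lin_beta -[X in eb * X]addr0; apply: (arc_upper bb db eb0 cb).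
- by rewrite -lin_beta H2.
- by rewrite -lin_beta H2.
- by rewrite normr0.
Qed.

(** Two applications of [arc_lower], the direction [b] being fixed; [et <= a] keeps the bound
    nonnegative for the second one. *)
Lemma box_lower e (t0 t1 p0 p1 b et ep a : R) :
  in_cube e -> 0 < t1 - t0 < pi -> 0 < p1 - p0 < pi -> 0 <= et -> 0 <= ep ->
  1 <= (1 + et) * cos ((t1 - t0) / 2) -> 1 <= (1 + ep) * cos ((p1 - p0) / 2) ->
  et <= a ->
  (forall t p, t \in [:: t0; t1] -> p \in [:: p0; p1] -> a <= lin e t p b) ->
  forall t p, t0 <= t <= t1 -> p0 <= p <= p1 ->
    a - et - ep * (1415%:R / 1000%:R) <= lin e t p b.
Proof.
move=> ee dt dp et0 ep0 ct cp ea H t p tt pp.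
have i0 (x y : R) : x \in [:: x; y] by rewrite !inE eqxx.
have i1 (x y : R) : y \in [:: x; y] by rewrite !inE eqxx orbT.
have a0 : 0 <= a by apply: le_trans ea.
have H1 p' : p' \in [:: p0; p1] -> a - et <= lin e t p' b.
  move=> p'i; rewrite lin_theta -[et in a - et]mulr1.
  apply: (arc_lower tt dt et0 ct a0).
  - by rewrite -lin_theta H.
  - by rewrite -lin_theta H.
  - exact: theta_const.
rewrite lin_phi; apply: (arc_lower pp dp ep0 cp).
- by rewrite subr_ge0.
- by rewrite -lin_phi H1.
- by rewrite -lin_phi H1.
- exact: phi_const.
Qed.

End Direction.

(** * Width of the polyhedron and the obstruction to a passage *)

Section Passage.
Variable R : realType.

Lemma conv_nth (V : lmodType R) (pts : seq V) k : (k < size pts)%N -> Defs.conv pts pts`_k.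
Proof.
move=> kn; exists (fun i => (i == Ordinal kn)%:R); split; first by move=> i; rewrite ler0n.
split; rewrite (bigD1 (Ordinal kn))//= eqxx.
  by rewrite big1 ?addr0// => i /negPf->.
by rewrite scale1r big1 ?addr0// => i /negPf->; rewrite scale0r.
Qed.

Definition eval3 (c0 c1 c2 : R) (v : 'rV[R]_3) : R :=
  c0 * v ord0 0 + c1 * v ord0 1 + c2 * v ord0 2%:R.

Lemma eval3_pt3 c0 c1 c2 x y z : eval3 c0 c1 c2 (pt3 x y z) = c0 * x + c1 * y + c2 * z.
Proof. by rewrite /eval3 !mxE. Qed.

Lemma eval3_conv_le c0 c1 c2 (pts : seq 'rV[R]_3) m v :
  (forall p, p \in pts -> eval3 c0 c1 c2 p <= m) -> Defs.conv pts v -> eval3 c0 c1 c2 v <= m.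
Proof.
move=> H [w [w0 [w1 ->]]].
have -> : eval3 c0 c1 c2 (\sum_i w i *: pts`_i) = \sum_i w i * eval3 c0 c1 c2 pts`_i.
  rewrite /eval3 !summxE !mulr_sumr -!big_split/=; apply: eq_bigr => i _.
  by rewrite !mxE; ring.
rewrite -[m]mul1r -w1 mulr_suml; apply: ler_sum => i _.
by rewrite ler_wpM2l// H// mem_nth.
Qed.

Lemma dir_norm (t p b : R) : dirx t p b ^+ 2 + diry t p b ^+ 2 + dirz t p b ^+ 2 = 1.
Proof.
have -> : dirx t p b ^+ 2 + diry t p b ^+ 2 + dirz t p b ^+ 2 =
  (cos b ^+ 2 + sin b ^+ 2 * cos p ^+ 2) * (cos t ^+ 2 + sin t ^+ 2) +
   sin b ^+ 2 * sin p ^+ 2 by rewrite /dirx /diry /dirz; ring.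
by rewrite cos2Dsin2 mulr1 -addrA -mulrDr cos2Dsin2 mulr1 cos2Dsin2.
Qed.

Lemma abs_le_sqrt3 (s : R) : s ^+ 2 <= 3%:R -> `|s| <= 1733%:R / 1000%:R.
Proof.
move=> s3; apply: le_of_sqr; first by lra.
by rewrite real_normK ?num_real//; lra.
Qed.

Lemma norm_le_half (x y r : R) : `|x + y| <= r -> `|x - y| <= r -> `|x| <= r /\ `|y| <= r.
Proof.
move=> h1 h2; have tw (z : R) : `|z + z| <= r + r -> `|z| <= r.
  by rewrite -mulr2n normrMn -mulr2n lerMn2r.
split; apply: tw.
  by rewrite -[x + x](_ : (x + y) + (x - y) = _) ?(le_trans (ler_normD _ _)) ?lerD//; ring.
by rewrite -[y + y](_ : (x + y) - (x - y) = _) ?(le_trans (ler_normB _ _)) ?lerD//; ring.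
Qed.

(** As [11/20] lies in [[-1, 1]], the left side is a convex combination of [u - v] and [u + v]. *)
Lemma norm_skew_le (u v r : R) : `|u - v| <= 2 * r -> `|u + v| <= 2 * r ->
  `|u + 11%:R / 20%:R * v| <= 2 * r.
Proof. by rewrite !ler_norml => /andP[? ?] /andP[? ?]; apply/andP; split; lra. Qed.

(* Besides the tetrahedron's edges, only the pairs [p_i, q_i] matter; these
   are at distance [31/20 * sqrt 3 < 2 * 1344/1000]. *)
Lemma vertices_width (X Y Z r : R) v w :
  let pts := [:: pt3 1 1 1; pt3 1 (-1) (-1); pt3 (-1) 1 (-1); pt3 (-1) (-1) 1;
    pt3 (-(11%:R / 20%:R)) (-(11%:R / 20%:R)) (-(11%:R / 20%:R));
    pt3 (-(11%:R / 20%:R)) (11%:R / 20%:R) (11%:R / 20%:R);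
    pt3 (11%:R / 20%:R) (-(11%:R / 20%:R)) (11%:R / 20%:R);
    pt3 (11%:R / 20%:R) (11%:R / 20%:R) (-(11%:R / 20%:R))] in
  X ^+ 2 + Y ^+ 2 + Z ^+ 2 = 1 -> 1344%:R / 1000%:R <= r ->
  `|X + Y| <= r -> `|X - Y| <= r -> `|X + Z| <= r -> `|X - Z| <= r ->
  `|Y + Z| <= r -> `|Y - Z| <= r -> v \in pts -> w \in pts ->
  eval3 X Y Z v - eval3 X Y Z w <= 2 * r.
Proof.
move=> pts n1 r0 hXY hXY' hXZ hXZ' hYZ hYZ'.
have [hX hY] := norm_le_half hXY hXY'; have [_ hZ] := norm_le_half hXZ hXZ'.
pose a : R := 11%:R / 20%:R.
(* The values of the functional at [p_0, ..., p_3]; since [q_k = - a * p_k], its values at the [q_k]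
   are [- a] times these. Each is at most [sqrt 3] in absolute value by Cauchy-Schwarz. *)
pose S := [:: X + Y + Z; X - Y - Z; Y - X - Z; Z - X - Y].
have Snorm u : u \in S -> `|u| <= 1733%:R / 1000%:R.
  have c1 := sqr_ge0 (X + Y); have c2 := sqr_ge0 (X - Y); have c3 := sqr_ge0 (X + Z).
  have c4 := sqr_ge0 (X - Z); have c5 := sqr_ge0 (Y + Z); have c6 := sqr_ge0 (Y - Z).
  by rewrite !inE => /or4P[] /eqP->; apply: abs_le_sqrt3;
    clear -n1 c1 c2 c3 c4 c5 c6; nra.
have two (x : R) : `|x| <= r -> `|2 * x| <= 2 * r.
  by move=> h; rewrite normrM (ger0_norm (ler0n _ 2)) ler_wpM2l.
(* Differences handle two [p] or two [q] vertices; sums are needed for mixed pairs, through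
   [norm_skew_le]. *)
pose close (u u' : R) := `|u - u'| <= 2 * r /\ `|u + u'| <= 2 * r.
have closeC u u' : close u u' -> close u' u.
  by case=> h1 h2; split; [rewrite distrC|rewrite addrC].
have mk u u' x y : u - u' = 2 * x -> u + u' = 2 * y -> `|x| <= r -> `|y| <= r -> close u u'.
  by rewrite /close => -> -> hx hy; split; apply: two.
have c01 : close (X + Y + Z) (X - Y - Z).
  by apply: (mk _ _ (Y + Z) X) => //; ring.
have c02 : close (X + Y + Z) (Y - X - Z).
  by apply: (mk _ _ (X + Z) Y) => //; ring.
have c03 : close (X + Y + Z) (Z - X - Y).
  by apply: (mk _ _ (X + Y) Z) => //; ring.
have c12 : close (X - Y - Z) (Y - X - Z).
  by apply: (mk _ _ (X - Y) (- Z)); rewrite ?normrN//; ring.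
have c13 : close (X - Y - Z) (Z - X - Y).
  by apply: (mk _ _ (X - Z) (- Y)); rewrite ?normrN//; ring.
have c23 : close (Y - X - Z) (Z - X - Y).
  by apply: (mk _ _ (Y - Z) (- X)); rewrite ?normrN//; ring.
have Sclose u u' : u \in S -> u' \in S -> u = u' \/ close u u'.
  by rewrite !inE => /or4P[]/eqP-> /or4P[]/eqP->; auto.
have Sv x : x \in pts -> exists2 u, u \in S &
    eval3 X Y Z x = u \/ eval3 X Y Z x = - (a * u).
  rewrite !inE; move=> /or4P[/eqP->|/eqP->|/eqP->|].
  - by exists (X + Y + Z); [rewrite !inE eqxx|rewrite eval3_pt3; left; ring].
  - by exists (X - Y - Z); [rewrite !inE eqxx ?orbT|rewrite eval3_pt3; left; ring].
  - by exists (Y - X - Z); [rewrite !inE eqxx ?orbT|rewrite eval3_pt3; left; ring].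
  move=> /orP[/eqP->|/or4P[] /eqP->].
  - by exists (Z - X - Y); [rewrite !inE eqxx ?orbT|rewrite eval3_pt3; left; ring].
  - by exists (X + Y + Z); [rewrite !inE eqxx|rewrite eval3_pt3; right; rewrite /a; ring].
  - by exists (X - Y - Z); [rewrite !inE eqxx ?orbT|rewrite eval3_pt3; right; rewrite /a; ring].
  - by exists (Y - X - Z); [rewrite !inE eqxx ?orbT|rewrite eval3_pt3; right; rewrite /a; ring].
  - by exists (Z - X - Y); [rewrite !inE eqxx ?orbT|rewrite eval3_pt3; right; rewrite /a; ring].
move=> /Sv[u uS vE] /Sv[u' u'S wE].
have r1 : 0 <= r by clear -r0; lra.
case: (Sclose _ _ uS u'S) => [uu'|[d s]].
  (* Same index: the extreme difference is [31/20 * |u|], and [31/20 * 1.733 < 2 * 1.344]. *)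
  subst u'; have := Snorm _ uS; rewrite ler_norml => /andP[n2 n3].
  by case: vE wE => -> [] ->; rewrite /a; clear -r0 r1 n2 n3; lra.
have [d1 d2] : u - u' <= 2 * r /\ u' - u <= 2 * r.
  by split; apply: le_trans d; rewrite ?ler_norm// -normrN opprB ler_norm.
case: vE wE => -> [] ->.
- exact: d1.
- rewrite opprK; apply: le_trans (norm_skew_le d s); exact: ler_norm.
- rewrite -opprD; apply: le_trans (norm_skew_le _ _).
  + by rewrite addrC -normrN; apply: ler_norm.
  + by rewrite distrC.
  + by rewrite addrC.
- by rewrite /a; clear -r1 d1 d2; lra.
Qed.

End Passage.

Section NoPassage.
Variable R : realType.
Implicit Types (e : R * R * R).

Lemma vertex_difference e (X Y Z : R) : e \in edges R -> exists v w,
  [/\ v \in [:: pt3 1 1 1; pt3 1 (-1) (-1); pt3 (-1) 1 (-1); pt3 (-1) (-1) 1 : 'rV[R]_3],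
      w \in [:: pt3 1 1 1; pt3 1 (-1) (-1); pt3 (-1) 1 (-1); pt3 (-1) (-1) 1 : 'rV[R]_3] &
      eval3 (- X) Y Z v - eval3 (- X) Y Z w = 2 * (e.1.1 * X + e.1.2 * Y + e.2 * Z)].
Proof.
pose p0 : 'rV[R]_3 := pt3 1 1 1; pose p1 : 'rV[R]_3 := pt3 1 (-1) (-1).
pose p2 : 'rV[R]_3 := pt3 (-1) 1 (-1); pose p3 : 'rV[R]_3 := pt3 (-1) (-1) 1.
rewrite !inE; do ![case/orP] => /eqP->.
- by exists p2, p1; rewrite !inE !eqxx ?orbT; split=> //; rewrite !eval3_pt3/=; ring.
- by exists p3, p0; rewrite !inE !eqxx ?orbT; split=> //; rewrite !eval3_pt3/=; ring.
- by exists p3, p1; rewrite !inE !eqxx ?orbT; split=> //; rewrite !eval3_pt3/=; ring.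
- by exists p2, p0; rewrite !inE !eqxx ?orbT; split=> //; rewrite !eval3_pt3/=; ring.
- by exists p0, p1; rewrite !inE !eqxx ?orbT; split=> //; rewrite !eval3_pt3/=; ring.
- by exists p2, p3; rewrite !inE !eqxx ?orbT; split=> //; rewrite !eval3_pt3/=; ring.
Qed.

Lemma Pa_vertex (a : R) v :
  v \in [:: pt3 1 1 1; pt3 1 (-1) (-1); pt3 (-1) 1 (-1); pt3 (-1) (-1) 1 : 'rV[R]_3] ->
  Pa a v.
Proof.
rewrite /Pa; set pts := (X in Defs.conv X).
rewrite !inE => /or4P[] /eqP->.
- exact: (@conv_nth _ _ pts 0).
- exact: (@conv_nth _ _ pts 1).
- exact: (@conv_nth _ _ pts 2).
- exact: (@conv_nth _ _ pts 3).
Qed.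

Lemma Pa_width (X Y Z r : R) v w :
  X ^+ 2 + Y ^+ 2 + Z ^+ 2 = 1 -> 1344%:R / 1000%:R <= r ->
  `|X + Y| <= r -> `|X - Y| <= r -> `|X + Z| <= r -> `|X - Z| <= r ->
  `|Y + Z| <= r -> `|Y - Z| <= r ->
  Pa (11%:R / 20%:R) v -> Pa (11%:R / 20%:R) w ->
  eval3 X Y Z v - eval3 X Y Z w <= 2 * r.
Proof.
move=> n1 r0 h1 h2 h3 h4 h5 h6 Pv Pw.
rewrite lerBlDr; apply: eval3_conv_le Pv => p pin.
rewrite -lerBlDl -lerN2 opprB -[- _]/(- eval3 X Y Z w).
have -> : - eval3 X Y Z w = eval3 (- X) (- Y) (- Z) w by rewrite /eval3; ring.
apply: eval3_conv_le Pw => q qin.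
have -> : eval3 (- X) (- Y) (- Z) q = - eval3 X Y Z q by rewrite /eval3; ring.
have := vertices_width n1 r0 h1 h2 h3 h4 h5 h6 pin qin; lra.
Qed.

Definition probe (b : R) (v : 'rV[R]_2) : R := cos b * v ord0 0 + sin b * v ord0 1.

Lemma probe_proj t p b v :
  probe b (Mproj t p v) = eval3 (- dirx t p b) (diry t p b) (dirz t p b) v.
Proof. by rewrite /probe /Mproj !mxE /eval3 /= /dirx /diry /dirz; ring. Qed.

Lemma probe_rot a b v : probe (b + a) (Rot a v) = probe b v.
Proof.
rewrite /probe /Rot !mxE/= cosD sinD.
transitivity ((cos a ^+ 2 + sin a ^+ 2) * (cos b * v ord0 0 + sin b * v ord0 1)).
  by ring.
by rewrite cos2Dsin2 mul1r.
Qed.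

(** The first shadow has width at least [2 * r] in direction [b], so its rotated copy scaled by
    [s > 1] is wider than [2 * r] in direction [b + alpha], where the second shadow has width at
    most [2 * r]. *)
Lemma no_passage (alpha t p t' p' b r : R) e :
  1344%:R / 1000%:R <= r -> e \in edges R -> r <= `|lin e t p b| ->
  (forall f, f \in edges R -> `|lin f t' p' (b + alpha)| <= r) ->
  ~ rupert_passage (Pa (11%:R / 20%:R)) alpha t p t' p'.
Proof.
move=> r0 ee er fr [s [s1 [u fits]]].
have [v [w [vin win vw]]] : exists v w,
  [/\ Pa (11%:R / 20%:R) v, Pa (11%:R / 20%:R) w &
   2 * r <= probe b (Mproj t p v) - probe b (Mproj t p w)].
  have [v [w [vin win vw]]] := vertex_difference (dirx t p b) (diry t p b) (dirz t p b) ee.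
  have [l0|l0] := leP 0 (lin e t p b).
    exists v, w; split; [exact: Pa_vertex|exact: Pa_vertex|].
    by rewrite !probe_proj vw -/(lin e t p b) -{1}(ger0_norm l0) ler_pM2l.
  exists w, v; split; [exact: Pa_vertex|exact: Pa_vertex|].
  rewrite !probe_proj -opprB vw -/(lin e t p b) -mulrN.
  by rewrite ler_pM2l// -(ltr0_norm l0).
have image x : Pa (11%:R / 20%:R) x -> exists2 y, Pa (11%:R / 20%:R) y &
    Mproj t' p' y = s *: Rot alpha (Mproj t p x) + u.
  move=> Px; have : interior (Mproj t' p' @` Pa (11%:R / 20%:R))
      (s *: Rot alpha (Mproj t p x) + u).
    by apply: fits; exists (Rot alpha (Mproj t p x)) => //; exists x.
  by move=> /interior_subset[y Py yE]; exists y.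
have [y Py yE] := image _ vin; have [z Pz zE] := image _ win.
have probeD c x : probe c (s *: x + u) = s * probe c x + probe c u.
  by rewrite /probe !mxE; ring.
have : probe (b + alpha) (Mproj t' p' y) - probe (b + alpha) (Mproj t' p' z) <= 2 * r.
  rewrite !probe_proj.
  have f1 := fr (1, 1, 0) ltac:(by rewrite !inE eqxx).
  have f2 := fr (1, -1, 0) ltac:(by rewrite !inE eqxx !orbT).
  have f3 := fr (1, 0, 1) ltac:(by rewrite !inE eqxx !orbT).
  have f4 := fr (1, 0, -1) ltac:(by rewrite !inE eqxx !orbT).
  have f5 := fr (0, 1, 1) ltac:(by rewrite !inE eqxx !orbT).
  have f6 := fr (0, 1, -1) ltac:(by rewrite !inE eqxx !orbT).
  move: f1 f2 f3 f4 f5 f6; rewrite /lin/= !mul0r !mul1r !mulN1r !addr0 !add0r => f1 f2 f3 f4 f5 f6.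
  (* The first coordinate of the functional is [- dirx], which exchanges, up to sign, the sum and
     the difference in the edges that involve it. *)
  apply: Pa_width => //; first by rewrite sqrrN dir_norm.
  - by rewrite addrC distrC.
  - by rewrite -opprD normrN.
  - by rewrite addrC distrC.
  - by rewrite -opprD normrN.
rewrite yE zE !probeD !probe_rot opprD addrACA subrr addr0 -mulrBr.
have r2 : 0 < 2 * r by rewrite mulr_gt0//; lra.
move=> sl; have : s * (2 * r) <= 2 * r by rewrite (le_trans _ sl)// ler_pM2l//; lra.
by rewrite ger_pMl// leNgt s1.
Qed.

End NoPassage.

(** * Bounds on the cells of the grid *)

Lemma product_error (F : realFieldType) (S x y X Y ex ey : F) :
  0 <= S -> `|X| <= 1 -> `|Y| <= 1 -> `|x - S * X| <= ex -> `|y - S * Y| <= ey ->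
  `|x * y - S * S * (X * Y)| <= ex * (S + ey) + S * ey.
Proof.
move=> S0 X1 Y1 dx dy.
have -> : x * y - S * S * (X * Y) = (x - S * X) * y + S * X * (y - S * Y) by ring.
apply: le_trans (ler_normD _ _) _; rewrite lerD// normrM ler_pM//.
  rewrite -(subrK (S * Y) y) (le_trans (ler_normD _ _))// addrC lerD//.
  by rewrite normrM (ger0_norm S0) ler_piMr.
by rewrite normrM (ger0_norm S0) ler_piMr.
Qed.

(** Budget in units of [S]: about 1.02 for [cb * si], and 2.04 + 0.51 for [a * ci], where 2.04 is
    the error of the shifted product [a]. The total 3.57 is divided by [S >= 2 ^ 14]. *)
Lemma frame_error (F : realFieldType) (S cb sb ci si cj a Cb Sb Ci Si Cj : F) :
  (16 * 1024) <= S -> `|Cb| <= 1 -> `|Sb| <= 1 -> `|Ci| <= 1 -> `|Si| <= 1 -> `|Cj| <= 1 ->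
  `|cb - S * Cb| <= 51%:R / 100%:R -> `|sb - S * Sb| <= 51%:R / 100%:R ->
  `|ci - S * Ci| <= 51%:R / 100%:R -> `|si - S * Si| <= 51%:R / 100%:R ->
  `|cj - S * Cj| <= 51%:R / 100%:R -> a * S <= sb * cj < (a + 1) * S ->
  `|cb * si + a * ci - S * S * (Cb * Si + Sb * Cj * Ci)| <= 22%:R / (100 * 1000) * (S * S).
Proof.
move=> S0 Cb1 Sb1 Ci1 Si1 Cj1 dcb dsb dci dsi dcj /andP[al au].
have s0 : 0 <= S by lra.
have s1 : 0 < S by lra.
have h1 := product_error s0 Cb1 Si1 dcb dsi.
have h2 := product_error s0 Sb1 Cj1 dsb dcj.
have SC1 : `|Sb * Cj| <= 1 by rewrite normrM mulr_ile1.
have h3 : `|a - S * (Sb * Cj)| <= 204%:R / 100%:R.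
  move: h2; rewrite !ler_norml => /andP[h21 h22].
  by apply/andP; split; rewrite -(ler_pM2r s1) mulrBl [S * _ * S]mulrAC;
    move: al au h21 h22; rewrite mulrDl;
    set u := a * S; set w := sb * cj; set z := S * S * _; lra.
have h4 := product_error s0 SC1 Ci1 h3 dci.
have -> : cb * si + a * ci - S * S * (Cb * Si + Sb * Cj * Ci) =
  (cb * si - S * S * (Cb * Si)) + (a * ci - S * S * (Sb * Cj * Ci)) by ring.
apply: le_trans (ler_normD _ _) _; apply: le_trans (lerD h1 h4) _.
have : (16 * 1024) * S <= S * S by rewrite ler_pM2r.
lra.
Qed.
Section Nodes.
Local Open Scope Z_scope.

(* The direction of [dirx, diry, dirz], scaled by [2 ^ 28]; the last argument is
   kept apart so that the products of the first two are shared along a row. *)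
Definition zvec (b j : Z * Z) : Z * Z -> Z * Z * Z :=
  let: (cb, sb) := b in let: (cj, sj) := j in
  let a := Z.shiftr (sb * cj) 14 in let z := sb * sj in
  fun i => let: (ci, si) := i in (cb * si + a * ci, cb * ci - a * si, z).

(** The sum of the two largest absolute coordinates, that is, the largest absolute value among
    [zedges v]. *)
Definition zdiam (v : Z * Z * Z) : Z :=
  let: (x, y, z) := v in
  let x := Z.abs x in let y := Z.abs y in let z := Z.abs z in
  x + y + z - Z.min x (Z.min y z).

Definition zedges (v : Z * Z * Z) : seq Z :=
  let: (x, y, z) := v in [:: x + y; x - y; x + z; x - z; y + z; y - z].

Lemma zdiam_ge v k : Z.abs (nth 0 (zedges v) k) <= zdiam v.
Proof. by case: v => [[x y] z]; case: k => [|[|[|[|[|[|[]]]]]]]; rewrite /zdiam/=; lia. Qed.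

Definition S18 : Z := Eval compute in 2 ^ 18.

(* Levels are in units of [1 / 1024]. The gap between the offsets 1375 of
   [qlevel] and 1378 of [plevel] absorbs the rounding errors and the variation
   of the directions inside a cell. *)
Definition qlevel (v : Z) : Z :=
  if v <? 1375 * S18 then 0 else Z.shiftr v 18 - 1374.

(** The [1374] in [qlevel] makes [1375 + qlevel v] the quotient plus one, a strict upper bound. *)
Lemma qlevel_gt v : v < (1375 + qlevel v) * S18.
Proof.
rewrite /qlevel; case: Z.ltb_spec => h; first lia.
rewrite Z.shiftr_div_pow2//.
have := Z.div_mod v S18; have := Z.mod_pos_bound v S18.
rewrite -[Z.pow 2 18]/S18; rewrite /S18; lia.
Qed.

Lemma qlevel_ge0 v : 0 <= qlevel v.
Proof.
rewrite /qlevel; case: Z.ltb_spec => // h.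
rewrite Z.shiftr_div_pow2// -[Z.pow 2 18]/S18.
suff : 1375 <= v / S18 by lia.
by apply: Z.div_le_lower_bound => //; rewrite Z.mul_comm.
Qed.

End Nodes.

Section NodeError.
Variable R : realType.
Local Notation zr := (@zr R).
Local Notation mesh := (mesh R).

Lemma S14_ge : (16 * 1024) <= zr S14.
Proof. rewrite -natrM -(zr_nat R (16 * 1024)%N); apply: zr_le; apply/Z.leb_le; by vm_compute. Qed.

Lemma zvecP b j i : (b <= 128)%N -> (j <= 128)%N -> (i <= 128)%N ->
  let: (x, y, z) := zvec (tg b) (tg j) (tg i) in
  let t := i%:R * mesh in let p := j%:R * mesh in let be := b%:R * mesh in
  let D := zr S14 * zr S14 in
  [/\ `|zr x - D * dirx t p be| <= 22%:R / (100 * 1000) * D,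
      `|zr y - D * diry t p be| <= 22%:R / (100 * 1000) * D &
      `|zr z - D * dirz t p be| <= 22%:R / (100 * 1000) * D].
Proof.
move=> /(tgP R)[] + + /(tgP R)[] + + /(tgP R)[].
case: (tg b) (tg j) (tg i) => [cb sb] [cj sj] [ci si].
set t := i%:R * mesh; set p := j%:R * mesh; set be := b%:R * mesh.
set D := zr S14 * zr S14 => /=.
move=> dcb dsb dcj dsj dci dsi.
have S0 := S14_ge.
have s0 : 0 <= zr S14 by lra.
have sh := @zr_shiftr R (Z.mul sb cj) 14 S14 ltac:(by []) (erefl _).
rewrite zrM in sh; split.
- rewrite zrD !zrM /dirx.
  by apply: (@frame_error _ _ _ (zr sb) _ (zr si) (zr cj)); rewrite ?cos_max ?sin_max.
(* [diry] is [dirx] with [(cos t, sin t)] replaced by [(- sin t, cos t)]. *)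
- have -> : zr (Z.sub (Z.mul cb ci) (Z.mul (Z.shiftr (Z.mul sb cj) 14) si)) - D * diry t p be =
    zr cb * zr ci + zr (Z.shiftr (Z.mul sb cj) 14) * (- zr si)
     - zr S14 * zr S14 * (cos be * cos t + sin be * cos p * (- sin t)).
    by rewrite zrB !zrM /diry /D; ring.
  apply: (@frame_error _ _ _ (zr sb) (- zr si) (zr ci) (zr cj)) => //;
    rewrite ?normrN ?cos_max ?sin_max//.
  by rewrite mulrN -opprD normrN.
- rewrite zrM /dirz.
  apply: le_trans (product_error s0 (sin_max be) (sin_max p) dsb dsj) _.
  have : (16 * 1024) * zr S14 <= zr S14 * zr S14 by rewrite ler_wpM2r.
  by rewrite /D; lra.
Qed.

Lemma norm_sum_error (D x y X Y e : R) : `|x - D * X| <= e -> `|y - D * Y| <= e ->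
  `|x + y - D * (X + Y)| <= 2 * e /\ `|x - y - D * (X - Y)| <= 2 * e.
Proof.
move=> hx hy; rewrite mulrDl mul1r; split.
  rewrite mulrDr opprD addrACA; apply: le_trans (ler_normD _ _) _; exact: lerD.
rewrite mulrBr opprB [X in `|X|](_ : _ = (x - D * X) - (y - D * Y)); last by ring.
by apply: le_trans (ler_normB _ _) _; exact: lerD.
Qed.

Lemma zedgesP b j i k : (b <= 128)%N -> (j <= 128)%N -> (i <= 128)%N -> (k < 6)%N ->
  `|zr (nth Z0 (zedges (zvec (tg b) (tg j) (tg i))) k) -
    zr S14 * zr S14 * lin (nth (0, 0, 0) (edges R) k) (i%:R * mesh) (j%:R * mesh) (b%:R * mesh)|
  <= 2 * (22%:R / (100 * 1000) * (zr S14 * zr S14)).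
Proof.
move=> hb hj hi hk; have := zvecP hb hj hi.
case: (zvec _ _ _) => [[x y] z]; set t := i%:R * _; set p := j%:R * _; set be := b%:R * _.
set D := zr S14 * _ => /= -[].
rewrite /lin; set X := dirx _ _ _; set Y := diry _ _ _; set Z := dirz _ _ _.
move=> hx hy hz.
have [xy1 xy2] := norm_sum_error hx hy; have [xz1 xz2] := norm_sum_error hx hz.
have [yz1 yz2] := norm_sum_error hy hz.
case: k hk => [|[|[|[|[|[|[]]]]]]]// _; rewrite [nth _ _ _]/= ?zrB ?zrD.
all: by rewrite [nth _ _ _]/= !(mul0r, mul1r, mulN1r, addr0, add0r).
Qed.

Lemma S28E : zr S14 * zr S14 = 1024%:R * zr S18.
Proof. by rewrite -(zr_nat R 1024) -!zrM. Qed.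

Lemma S18_gt0 : 0 < zr S18.
Proof. by rewrite -(zr0 R); apply: zr_lt. Qed.

Definition qnode b j i : Z := qlevel (zdiam (zvec (tg b) (tg j) (tg i))).

Lemma qnodeP b j i e : (b <= 128)%N -> (j <= 128)%N -> (i <= 128)%N -> e \in edges R ->
  `|lin e (i%:R * mesh) (j%:R * mesh) (b%:R * mesh)| <=
  (1375%:R + zr (qnode b j i)) / 1024%:R + 44%:R / (100 * 1000).
Proof.
move=> hb hj hi /(nthP (0, 0, 0))[k k6 <-].
have := zedgesP hb hj hi k6; have := @zdiam_ge (zvec (tg b) (tg j) (tg i)) k.
have := qlevel_gt (zdiam (zvec (tg b) (tg j) (tg i))); rewrite -/(qnode b j i).
move=> lt_q le_d; have {lt_q le_d} := Z.lt_le_incl _ _ (Z.le_lt_trans _ _ _ le_d lt_q).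
move=> /(zr_le R); rewrite zr_abs zrM zrD (zr_nat R 1375) S28E.
set L := lin _ _ _ _; set n := zr (nth _ _ _); set q := zr (qnode _ _ _).
move=> nq dn; have s0 := S18_gt0; set s := zr S18 in s0 nq dn *.
have K0 : 0 < 1024%:R :> R by rewrite ltr0n.
move: dn; move: K0; set K : R := 1024%:R => K0 dn.
have Ks0 : 0 < K * s by rewrite mulr_gt0.
have := ler_distD n 0 (K * s * L); rewrite sub0r normrN sub0r normrN normrM.
rewrite (gtr0_norm Ks0) => tri.
rewrite -(ler_pM2l Ks0) mulrDr [K * s * (_ / K)](_ : _ = (1375%:R + q) * s); last first.
  by rewrite mulrC -mulrA [K^-1 * _]mulrA mulVf ?gt_eqF// mul1r.
apply: (le_trans tri); rewrite lerD//.
by apply: (le_trans dn); lra.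
Qed.

End NodeError.

(** * The diameter and its symmetries *)

Section Diameter.
Variable R : realType.
Implicit Types t p b m : R.

(** As [|x| + |y|] is the maximum of [|x + y|] and [|x - y|], this is the largest [|lin e t p b|]
    over the six edges; absolute coordinates make the symmetries visible. *)
Definition diam t p b : R :=
  Num.max (`|dirx t p b| + `|diry t p b|)
    (Num.max (`|dirx t p b| + `|dirz t p b|) (`|diry t p b| + `|dirz t p b|)).

Lemma addr_norm_max (x y : R) : `|x| + `|y| = Num.max `|x + y| `|x - y|.
Proof.
apply/le_anti/andP; split; last first.
  by rewrite ge_max ler_normD ler_normB.
rewrite le_max; case: (ger0P x) => _; case: (ger0P y) => _; apply/orP.
- by left; apply: ler_norm.
- by right; apply: ler_norm.
- by right; rewrite -normrN opprB addrC; apply: ler_norm.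
- by left; rewrite -normrN -opprD; apply: ler_norm.
Qed.

Lemma diam_leP t p b m :
  (forall e, e \in edges R -> `|lin e t p b| <= m) <-> diam t p b <= m.
Proof.
have E x y z : lin (x, y, z) t p b = x * dirx t p b + y * diry t p b + z * dirz t p b by [].
rewrite /diam !addr_norm_max !ge_max; split.
  move=> H.
  have := H (1, 1, 0) ltac:(by rewrite !inE eqxx ?orbT).
  have := H (1, -1, 0) ltac:(by rewrite !inE eqxx ?orbT).
  have := H (1, 0, 1) ltac:(by rewrite !inE eqxx ?orbT).
  have := H (1, 0, -1) ltac:(by rewrite !inE eqxx ?orbT).
  have := H (0, 1, 1) ltac:(by rewrite !inE eqxx ?orbT).
  have := H (0, 1, -1) ltac:(by rewrite !inE eqxx ?orbT).
  by rewrite !E !mul0r !mul1r !mulN1r !addr0 !add0r => -> -> -> -> -> ->.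
move=> /andP[/andP[h1 h2] /andP[/andP[h3 h4] /andP[h5 h6]]] e.
rewrite !inE; do ![case/orP]; move/eqP->; rewrite E.
all: by rewrite !(mul0r, mul1r, mulN1r, addr0, add0r).
Qed.

Lemma diam_geP t p b m : (exists2 e, e \in edges R & m <= `|lin e t p b|) <-> m <= diam t p b.
Proof.
split=> [[e ee em]|].
  by apply: le_trans em _; have [_] := diam_leP t p b (diam t p b); apply.
have E x y z : lin (x, y, z) t p b = x * dirx t p b + y * diry t p b + z * dirz t p b by [].
have W e : e \in edges R -> m <= `|lin e t p b| ->
  exists2 e, e \in edges R & m <= `|lin e t p b| by exists e.
rewrite /diam !addr_norm_max !le_max -!orbA.
by case/orP => [h|]; [|case/orP => [h|]; [|case/orP => [h|]; [|case/orP => [h|]; [|case/orP => h]]]];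
  [apply: (W (1, 1, 0))|apply: (W (1, -1, 0))|apply: (W (1, 0, 1))|
   apply: (W (1, 0, -1))|apply: (W (0, 1, 1))|apply: (W (0, 1, -1))];
  rewrite ?inE ?eqxx ?orbT// E !(mul0r, mul1r, mulN1r, addr0, add0r).
Qed.

(** The reflection exchanges [dirx] and [diry] once [b] changes sign. [diam_phi] reverses [b] too,
    while [diam_phi2] does not. *)
Lemma diam_theta t p b : diam (pi / 2 - t) p b = diam t p (- b).
Proof.
have sE : sin (pi / 2 - t) = cos t by rewrite sinB sin_pihalf cos_pihalf mul1r mul0r subr0.
have cE : cos (pi / 2 - t) = sin t by rewrite cosB sin_pihalf cos_pihalf mul1r mul0r add0r.
have -> : diam t p (- b) = Num.max (`|diry t p (- b)| + `|dirx t p (- b)|)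
    (Num.max (`|diry t p (- b)| + `|dirz t p (- b)|) (`|dirx t p (- b)| + `|dirz t p (- b)|)).
  by rewrite /diam addrC; congr Num.max; rewrite maxC.
have -> : diry t p (- b) = dirx (pi / 2 - t) p b.
  by rewrite /diry /dirx sE cE sinN cosN; ring.
have -> : dirx t p (- b) = diry (pi / 2 - t) p b.
  by rewrite /diry /dirx sE cE sinN cosN; ring.
have -> // : dirz t p (- b) = - dirz (pi / 2 - t) p b by rewrite /dirz sinN; ring.
by rewrite /diam normrN.
Qed.

Lemma diam_phi t p b : diam t (pi - p) b = diam t p (- b).
Proof.
have sE : sin (pi - p) = sin p by rewrite addrC sinDpi sinN opprK.
have cE : cos (pi - p) = - cos p by rewrite addrC cosDpi cosN.
rewrite /diam.
have -> : dirx t p (- b) = dirx t (pi - p) b by rewrite /dirx cE sinN cosN; ring.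
have -> : diry t p (- b) = diry t (pi - p) b by rewrite /diry cE sinN cosN; ring.
have -> : dirz t p (- b) = - dirz t (pi - p) b by rewrite /dirz sE sinN; ring.
by rewrite normrN.
Qed.

Lemma diam_phi2 t p b : diam t (pi *+ 2 - p) b = diam t p b.
Proof.
have sE : sin (pi *+ 2 - p) = - sin p by rewrite addrC sinD2pi sinN.
have cE : cos (pi *+ 2 - p) = cos p by rewrite addrC cosD2pi cosN.
rewrite /diam; have -> : dirz t (pi *+ 2 - p) b = - dirz t p b.
  by rewrite /dirz sE; ring.
by rewrite /dirx /diry cE normrN.
Qed.

Lemma diamDpi t p b : diam t p (b + pi) = diam t p b.
Proof.
rewrite /diam.
have -> : dirx t p (b + pi) = - dirx t p b by rewrite /dirx sinDpi cosDpi; ring.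
have -> : diry t p (b + pi) = - diry t p b by rewrite /diry sinDpi cosDpi; ring.
have -> : dirz t p (b + pi) = - dirz t p b by rewrite /dirz sinDpi; ring.
by rewrite !normrN.
Qed.

Lemma diamDnpi t p b n : diam t p (b + n%:R * pi) = diam t p b.
Proof.
elim: n => [|n IH]; first by rewrite mul0r addr0.
by rewrite -addn1 natrD mulrDl mul1r addrA diamDpi.
Qed.

End Diameter.

(** * Levels of the cells and the bounds they certify *)

Section Cells.
Local Open Scope Z_scope.

(** Cells of the second shadow have side [2 * mesh] in both projection angles, hence the doubled
    indices, and side [mesh] in the direction. The maximum over eight corners is taken one axis at a
    time. *)
Definition qrow b j i := Z.max (qnode b j.*2 i.*2) (qnode b j.*2 i.+1.*2).
Definition qplane b j i := Z.max (qrow b j i) (qrow b j.+1 i).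
Definition qcell c j i := Z.max (qplane c j i) (qplane c.+1 j i).

Lemma qcell_ge c j i c' j' i' : (c' = c \/ c' = c.+1) -> (j' = j \/ j' = j.+1) ->
  (i' = i \/ i' = i.+1) -> qnode c' j'.*2 i'.*2 <= qcell c j i.
Proof.
by rewrite /qcell /qplane /qrow => -[->|->] [->|->] [->|->]; lia.
Qed.

Lemma qcell_ge0 c j i : 0 <= qcell c j i.
Proof.
by apply: Z.le_trans (qcell_ge (or_introl erefl) (or_introl erefl) (or_introl erefl));
  apply: qlevel_ge0.
Qed.

(** For four values of one strict sign, their least absolute value; otherwise at most 0, as nothing
    then bounds [|lin|] from below. *)
Definition same_sign_bound (a b c d : Z) : Z :=
  Z.max (Z.min (Z.min a b) (Z.min c d)) (- Z.max (Z.max a b) (Z.max c d)).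

Fixpoint best4 (a b c d : seq Z) : Z :=
  match a, b, c, d with
  | x :: a', y :: b', z :: c', t :: d' =>
    Z.max (same_sign_bound x y z t) (best4 a' b' c' d')
  | _, _, _, _ => 0
  end.

Lemma best4P a b c d : 0 < best4 a b c d -> exists2 k, (k < size a)%N &
  best4 a b c d <= same_sign_bound (nth 0 a k) (nth 0 b k) (nth 0 c k) (nth 0 d k).
Proof.
elim: a b c d => [|x a IH] [|y b] [|z c] [|t d]//=.
set s := same_sign_bound _ _ _ _; set r := best4 _ _ _ _ => h.
have [rs|sr] := Z.le_gt_cases r s; first by exists 0%N => //=; rewrite -/s; lia.
have /IH[k ka kr] : 0 < r by lia.
by exists k.+1 => //=; rewrite -/r in kr; lia.
Qed.

Definition pnode b i j := zedges (zvec (tg b) (tg j) (tg i)).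

Definition plevel (b i j : nat) : Z :=
  Z.shiftr (best4 (pnode b i j) (pnode b i.+1 j) (pnode b i j.+1) (pnode b i.+1 j.+1)) 18
  - 1378.

Lemma size_pnode b i j : size (pnode b i j) = 6%N.
Proof. by rewrite /pnode; case: (zvec _ _ _) => [[]]. Qed.

Lemma plevelP b i j : 0 <= plevel b i j -> exists2 k, (k < 6)%N & exists s : bool,
  forall i' j', (i' = i \/ i' = i.+1) -> (j' = j \/ j' = j.+1) ->
  (1378 + plevel b i j) * S18 <= (if s then - nth 0 (pnode b i' j') k else nth 0 (pnode b i' j') k).
Proof.
rewrite /plevel; set m := best4 _ _ _ _; rewrite Z.shiftr_div_pow2// -[Z.pow 2 18]/S18.
have mS := Z.mul_div_le m S18 ltac:(by []); set q := Z.div m S18 in mS * => q0.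
have /best4P[k] : 0 < m by rewrite /S18 in mS; lia.
rewrite size_pnode -/m => k6 km; exists k => //.
move: km; rewrite /same_sign_bound => km.
have -> : 1378 + (q - 1378) = q by lia.
have [|] : m <= Z.min (Z.min (nth 0 (pnode b i j) k) (nth 0 (pnode b i.+1 j) k))
   (Z.min (nth 0 (pnode b i j.+1) k) (nth 0 (pnode b i.+1 j.+1) k)) \/
  m <= - Z.max (Z.max (nth 0 (pnode b i j) k) (nth 0 (pnode b i.+1 j) k))
   (Z.max (nth 0 (pnode b i j.+1) k) (nth 0 (pnode b i.+1 j.+1) k)) by lia.
- by move=> h; exists false => i' j' [->|->] [->|->]; lia.
- by move=> h; exists true => i' j' [->|->] [->|->]; lia.
Qed.

End Cells.

Section CellBounds.
Variable R : realType.
Local Notation zr := (@zr R).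
Local Notation mesh := (mesh R).

(** The common threshold for both shadows: [63 / 10 ^ 5] covers the rounding error [44 / 10 ^ 5] and
    the loss [eps1 * (1 + 1.415)] on a cell of the first one. *)
Definition level_value (q : Z) : R := (1378%:R + zr q) / 1024%:R - 63%:R / (100 * 1000).

Lemma cos_mesh_ge : 1 - 3012%:R / (10 * 1000 * 1000) <= cos mesh.
Proof.
have := cos_stepP R; rewrite ler_norml => /andP[_].

have : zr (Z.mul 10 (Z.mul (Z.mul 1000 1000) (Z.add (Z.sub S40 cos_step) 2))) <=
   zr (Z.mul 3012 S40) by apply: zr_le; apply/Z.leb_le; vm_compute.
rewrite !zrM zrD zrB (zr_nat R 10) (zr_nat R 1000) (zr_nat R 2) (zr_nat R 3012).
have S0 : 0 < zr S40 by rewrite -(zr0 R); apply: zr_lt.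
move: S0; set S := zr S40; set C := zr cos_step; set c := cos mesh => S0 h1 h2.
by rewrite -(ler_pM2l S0); lra.
Qed.

(* [1 + eps1] and [1 + eps2] exceed the secants of half the sides [mesh] and
   [2 * mesh] of the cells. *)
Definition eps1 : R := 754%:R / (10 * 1000 * 1000).
Definition eps2 : R := 3013%:R / (10 * 1000 * 1000).

Lemma eps2P : 1 <= (1 + eps2) * cos mesh.
Proof.
apply: (@le_trans _ _ ((1 + eps2) * (1 - 3012%:R / (10 * 1000 * 1000)))).
  by rewrite /eps2; lra.
by rewrite ler_wpM2l ?cos_mesh_ge// /eps2; lra.
Qed.

Lemma mesh_lt : 2 * mesh < pi / 2.
Proof.
have -> : pi / 2 = 64%:R * mesh by rewrite /mesh; field.
by rewrite ltr_pM2r ?mesh_gt0//; lra.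
Qed.

Lemma eps1P : 1 <= (1 + eps1) * cos (mesh / 2).
Proof.
have m0 := mesh_gt0 R; have ml := mesh_lt.
have c0 : 0 <= cos (mesh / 2) by apply: cos_ge0_pihalf; apply/andP; split; lra.
apply: le_of_sqr; first by rewrite mulr_ge0// /eps1; lra.
have e : cos mesh = 2 * cos (mesh / 2) ^+ 2 - 1.
  by rewrite -[in LHS](_ : mesh / 2 *+ 2 = mesh) ?cos_mulr2n; [ring|field].
have := cos_mesh_ge; rewrite e exprMn expr1n /eps1; set y := _ ^+ 2 in e *.
by move=> h; lra.
Qed.

Lemma mesh_half (n : nat) : ((n.+1%:R * mesh - n%:R * mesh) / 2) = mesh / 2.
Proof. by rewrite -mulrBl -addn1 natrD addrAC subrr add0r mul1r. Qed.

Lemma mesh2_half (n : nat) : ((n.+1.*2%:R * mesh - n.*2%:R * mesh) / 2) = mesh.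
Proof. by rewrite -mulrBl doubleS -addn2 natrD addrAC subrr add0r mulrAC divff ?mul1r. Qed.

Lemma zr_qcell_node c j i c' j' i' : (c' = c \/ c' = c.+1) -> (j' = j \/ j' = j.+1) ->
  (i' = i \/ i' = i.+1) -> zr (qnode c' j'.*2 i'.*2) <= zr (qcell c j i).
Proof. by move=> *; apply/zr_le/qcell_ge. Qed.

(** The cap [72] keeps the corner bound near [sqrt 2], the length of a halved edge, so that the
    growth inside the cell fits in the gap of [3 / 1024] between the two offsets. *)
Lemma qcell_upper c j i t p b : (c < 128)%N -> (j < 32)%N -> (i < 16)%N ->
  Z.le (qcell c j i) 72 ->
  i.*2%:R * mesh <= t <= i.+1.*2%:R * mesh -> j.*2%:R * mesh <= p <= j.+1.*2%:R * mesh ->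
  c%:R * mesh <= b <= c.+1%:R * mesh -> diam t p b <= level_value (qcell c j i).
Proof.
move=> hc hj hi q72 tt pp bb; apply/diam_leP => e ee.
have m0 := mesh_gt0 R; have ml := mesh_lt.
pose a := (1375%:R + zr (qcell c j i)) / 1024%:R + 44%:R / (100 * 1000).
have corner t' p' b' : t' \in [:: i.*2%:R * mesh; i.+1.*2%:R * mesh] ->
    p' \in [:: j.*2%:R * mesh; j.+1.*2%:R * mesh] ->
    b' \in [:: c%:R * mesh; c.+1%:R * mesh] -> `|lin e t' p' b'| <= a.
  have pick (f : nat -> nat) n x : x \in [:: (f n)%:R * mesh; (f n.+1)%:R * mesh] ->
      exists2 n', (n' = n \/ n' = n.+1) & x = (f n')%:R * mesh.
    by rewrite !inE => /orP[]/eqP->; [exists n|exists n.+1]; auto.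
  move=> /(pick double)[i' ii ->] /(pick double)[j' jj ->] /(pick id)[c' cc ->].
  apply: le_trans (qnodeP _ _ _ ee) _.
  - by clear -hc cc; lia.
  - by clear -hj jj; lia.
  - by clear -hi ii; lia.
  rewrite /a lerD2r ler_wpM2r ?invr_ge0 ?ler0n// lerD2l.
  exact: zr_qcell_node.
have e10 : 0 <= eps1 by rewrite /eps1; lra.
have e20 : 0 <= eps2 by rewrite /eps2; lra.
have w2 n : 0 < n.+1.*2%:R * mesh - n.*2%:R * mesh < pi.
  by clear -m0 ml; have := mesh2_half n; set w := _ - _ => ?; apply/andP; split; lra.
have w1 n : 0 < n.+1%:R * mesh - n%:R * mesh < pi.
  by clear -m0 ml; have := mesh_half n; set w := _ - _ => ?; apply/andP; split; lra.
have E2 n : 1 <= (1 + eps2) * cos ((n.+1.*2%:R * mesh - n.*2%:R * mesh) / 2).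
  by rewrite mesh2_half eps2P.
have E1 n : 1 <= (1 + eps1) * cos ((n.+1%:R * mesh - n%:R * mesh) / 2).
  by rewrite mesh_half eps1P.
apply: le_trans (box_upper (edges_in_cube ee) (w2 i) (w2 j) (w1 c) e20 e20 e10 (E2 _) (E2 _) (E1 _) corner tt pp bb) _.
have := zr_le R q72; rewrite (zr_nat R 72) /a /level_value /eps1 /eps2.
set q := zr _ => q72'; clear -q72'; lra.
Qed.

Lemma pcell_lower b i j t p q : (b <= 128)%N -> (i < 128)%N -> (j < 128)%N ->
  Z.le 0 q -> Z.le q (plevel b i j) ->
  i%:R * mesh <= t <= i.+1%:R * mesh -> j%:R * mesh <= p <= j.+1%:R * mesh ->
  level_value q <= diam t p (b%:R * mesh).
Proof.
move=> hb hi hj q0 qp tt pp; apply/diam_geP.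
have [|k k6 [s H]] := @plevelP b i j; first by lia.
pose e := nth (0, 0, 0) (edges R) k.
have ee : e \in edges R by apply: mem_nth.
exists e => //.
(* The edge is oriented so that [lin] is positive at all four corners, as [box_lower] requires. *)
pose e' : R * R * R := if s then (- e.1.1, - e.1.2, - e.2) else e.
have e'c : in_cube e'.
  by have := edges_in_cube ee; rewrite /e'; case: s {H e'} => // -[h1 h2 h3]; split; rewrite /= normrN.
have linE t' p' b' : lin e' t' p' b' = if s then - lin e t' p' b' else lin e t' p' b'.
  by rewrite /e'; case: s {H e' e'c} => //; rewrite /lin/=; ring.
suff : level_value q <= lin e' t p (b%:R * mesh).
  move=> h; apply: le_trans h _; rewrite linE; case: (s); last exact: ler_norm.
  by rewrite -normrN ler_norm.
have m0 := mesh_gt0 R; have ml := mesh_lt.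
pose a := (1378%:R + zr q) / 1024%:R - 44%:R / (100 * 1000).
have zq0 := zr_ge0 R q0.
have K0 : 0 < 1024%:R :> R by rewrite ltr0n.
have corner t' p' : t' \in [:: i%:R * mesh; i.+1%:R * mesh] ->
    p' \in [:: j%:R * mesh; j.+1%:R * mesh] -> a <= lin e' t' p' (b%:R * mesh).
  have pick n x : x \in [:: n%:R * mesh; n.+1%:R * mesh] ->
      exists2 n', (n' = n \/ n' = n.+1) & x = n'%:R * mesh.
    by rewrite !inE => /orP[]/eqP->; [exists n|exists n.+1]; auto.
  move=> /pick[i' ii ->] /pick[j' jj ->].
  have /(zr_le R) := H i' j' ii jj.
  have i128 : (i' <= 128)%N by case: ii => ->; first exact: ltnW.
  have j128 : (j' <= 128)%N by case: jj => ->; first exact: ltnW.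
  have := @zedgesP R b j' i' k hb j128 i128 k6; rewrite -/e -/(pnode b i' j').
  rewrite linE zrM zrD (zr_nat R 1378) S28E.
  have := zr_le R qp; set P := zr (plevel _ _ _) => qP.
  rewrite (fun_if zr) zrN; set n := zr (nth _ _ _); set L := lin e _ _ _.
  have := S18_gt0 R; rewrite /a; move: (K0); set S := zr S18; set K : R := 1024%:R => K1 S0.
  have KS0 : 0 < K * S by rewrite mulr_gt0.
  rewrite ler_norml => /andP[h1 h2] h3.
  have h4 : (1378%:R + zr q) * S <= if s then - n else n.
    by apply: le_trans h3; apply: ler_wpM2r; [exact: ltW|rewrite lerD2l].
  rewrite -(ler_pM2l KS0) mulrBr [K * S * (_ / K)](_ : _ = (1378%:R + zr q) * S); last first.
    by rewrite mulrC -mulrA [K^-1 * _]mulrA mulVf ?gt_eqF// mul1r.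
  by clear -h1 h2 h4; case: s h4 => h4; rewrite ?mulrN; lra.
have e10 : 0 <= eps1 by rewrite /eps1; lra.
have w1 n : 0 < n.+1%:R * mesh - n%:R * mesh < pi.
  by clear -m0 ml; have := mesh_half n; set w := _ - _ => ?; apply/andP; split; lra.
have E1 n : 1 <= (1 + eps1) * cos ((n.+1%:R * mesh - n%:R * mesh) / 2).
  by rewrite mesh_half eps1P.
have ea : eps1 <= a by rewrite /a /eps1; clear -zq0; lra.
apply: le_trans (box_lower e'c (w1 i) (w1 j) e10 e10 (E1 _) (E1 _) ea corner tt pp).
by rewrite /a /level_value /eps1; clear; lra.
Qed.

Lemma level_value_ge q : Z.le 0 q -> 1344%:R / 1000%:R <= level_value q.
Proof. by move=> /(zr_ge0 R) q0; rewrite /level_value; lra. Qed.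

End CellBounds.

(** * The count of good pairs of cells *)

Section Adjacent.

Fixpoint map2 (A B C : Type) (f : A -> B -> C) s t :=
  match s, t with
  | x :: s', y :: t' => f x y :: map2 f s' t'
  | _, _ => [::]
  end.

Fixpoint adj (A B : Type) (f : A -> A -> B) (s : seq A) : seq B :=
  match s with
  | x :: s' => match s' with
               | y :: _ => f x y :: adj f s'
               | [::] => [::]
               end
  | [::] => [::]
  end.

Lemma mkseqS (A : Type) (g : nat -> A) n : mkseq g n.+1 = g 0 :: mkseq (g \o succn) n.
Proof. by rewrite /mkseq/= (iotaDl 1 0) -map_comp. Qed.

Lemma map2_mkseq (A B C : Type) (f : A -> B -> C) g h n :
  map2 f (mkseq g n) (mkseq h n) = mkseq (fun i => f (g i) (h i)) n.
Proof. by elim: n g h => // n IH g h; rewrite !mkseqS/= IH. Qed.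

Lemma adj_mkseq (A B : Type) (f : A -> A -> B) g n :
  adj f (mkseq g n.+1) = mkseq (fun i => f (g i) (g i.+1)) n.
Proof.
elim: n g => // n IH g; rewrite [RHS]mkseqS.
have <- := IH (g \o succn); by rewrite !mkseqS.
Qed.

Lemma map_mkseq (A B : Type) (f : A -> B) g n : map f (mkseq g n) = mkseq (f \o g) n.
Proof. by rewrite /mkseq -map_comp. Qed.

End Adjacent.

Section GridCount.
Local Open Scope Z_scope.

Definition row_levels (ti : seq (Z * Z)) b j :=
  adj Z.max (map (fun i => qlevel (zdiam (zvec b j i))) ti).

Definition plane_levels (ti tj : seq (Z * Z)) b :=
  adj (map2 Z.max) (map (row_levels ti b) tj).

(** Computes each node once and then takes maxima of neighbours along each axis: 129, 33 and 17
    nodes give 128, 32 and 16 cells. *)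
Definition cell_levels :=
  adj (map2 (map2 Z.max))
    (map (plane_levels (mkseq (fun i => tg i.*2) 17) (mkseq (fun j => tg j.*2) 33))
         trig_table).

Lemma cell_levelsE : cell_levels =
  mkseq (fun c => mkseq (fun j => mkseq (fun i => qcell c j i) 16) 32) 128.
Proof.
have tE : trig_table = mkseq tg 129.
  by rewrite -(mkseq_nth (Z0, Z0) trig_table) size_map size_traject.
have rE b j : row_levels (mkseq (fun i => tg i.*2) 17) (tg b) (tg j.*2) =
    mkseq (fun i => qrow b j i) 16.
  by rewrite /row_levels map_mkseq adj_mkseq.
have pE b : plane_levels (mkseq (fun i => tg i.*2) 17) (mkseq (fun j => tg j.*2) 33) (tg b)
    = mkseq (fun j => mkseq (fun i => qplane b j i) 16) 32.
  rewrite /plane_levels map_mkseq adj_mkseq; apply: eq_mkseq => j.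
  by rewrite /comp !rE map2_mkseq.
rewrite /cell_levels tE map_mkseq adj_mkseq; apply: eq_mkseq => c.
rewrite /comp !pE map2_mkseq; apply: eq_mkseq => j.
by rewrite map2_mkseq.
Qed.

(* Coordinates of the projected edges in the basis of [cos b] and [sin b],
   scaled by [2 ^ 28]. *)
Definition frame (i j : Z * Z) : seq (Z * Z) :=
  map2 pair (zedges (S14 * i.2, S14 * i.1, 0))
            (zedges (j.1 * i.1, - (j.1 * i.2), S14 * j.2)).

Definition longest (s : seq (Z * Z)) : Z * Z :=
  foldr (fun p q => if q.1 * q.1 + q.2 * q.2 <=? p.1 * p.1 + p.2 * p.2
                    then p else q) (0, 0) s.

(** Binary search for the angle of a vector of the upper half-plane: the cross product is negative
    when the vector lies beyond the angle of index [m]. *)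
Fixpoint bisect (fuel w lo : nat) (x y : Z) : nat :=
  if fuel is n.+1 then
    let m := (lo + w)%N in
    bisect n w./2 (if x * (tg m).2 - y * (tg m).1 <? 0 then m else lo) x y
  else lo.

Definition add_pair (p q : Z * Z) := (p.1 + q.1, p.2 + q.2).

(* The index of the direction of the longest projected edge; nothing has to be
   proved about it, because [plevel] is a lower bound for every direction. *)
Definition hint (i j : nat) : nat :=
  let p := longest (map2 add_pair (frame (tg i) (tg j)) (frame (tg i.+1) (tg j.+1))) in
  let: (x, y) := if p.2 <? 0 then (- p.1, - p.2) else p in
  minn 128 (bisect 7 64 0 (Z.shiftr x 14) (Z.shiftr y 14)).

Definition best_plevel i j := plevel (hint i j) i j.

Definition zsum (s : seq Z) : Z := foldr Z.add 0 s.

Definition plevels : seq (seq Z) := mkseq (fun i => mkseq (best_plevel i) 64) 32.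

Definition zcount (s : seq Z) (k : Z) : Z :=
  zsum (map (fun p => if k <=? p then 1 else 0) s).

(** Tabulated so that each cell of the second kind costs one lookup instead of 2048 comparisons. *)
Definition above_table (s : seq Z) := mkseq (fun k => zcount s (Z.of_nat k)) 73.

Definition good_count : Z :=
  let t := above_table (flatten plevels) in
  zsum (map (fun pl => zsum (map (fun r => zsum (map
    (fun q => nth 0 t (Z.to_nat q)) r)) pl)) cell_levels).

(** [S40 / 2 ^ 13 = 2 ^ 27] is the number of pairs: [32 * 64] cells of the first kind times
    [128 * 32 * 16] of the second. *)
Lemma good_count_ge : (88 * (S40 / 2 ^ 13) <=? 100 * good_count) = true.
Proof. by vm_cast_no_check (erefl true). Qed.

Definition compatible c j' i' i j : bool :=
  (qcell c j' i' <=? 72) && (qcell c j' i' <=? best_plevel i j).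

Lemma zsum_mkseq f (g : nat -> nat) n : (forall i, (i < n)%N -> f i = Z.of_nat (g i)) ->
  zsum (mkseq f n) = Z.of_nat (\sum_(i < n) g i).
Proof.
elim: n f g => [|n IH] f g H; first by rewrite big_ord0.
rewrite mkseqS big_ord_recl Nat2Z.inj_add -H//= -(IH (f \o succn) (g \o succn))//.
by move=> i ni; apply: H.
Qed.

Lemma zsum_cat s t : zsum (s ++ t) = zsum s + zsum t.
Proof. by elim: s => //= x s ->; lia. Qed.

Lemma zcountE k : zcount (flatten plevels) k =
  Z.of_nat (\sum_(i < 32) \sum_(j < 64) Z.leb k (best_plevel i j))%N.
Proof.
have -> : zcount (flatten plevels) k = zsum (map (fun s => zcount s k) plevels).
  by elim: plevels => //= s l IH; rewrite /zcount map_cat zsum_cat; congr (_ + _); exact: IH.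
rewrite map_mkseq.
apply: (@zsum_mkseq _ (fun i => \sum_(j < 64) Z.leb k (best_plevel i j))%N) => i _.
rewrite /comp /zcount map_mkseq.
apply: (@zsum_mkseq _ (fun j => nat_of_bool (k <=? best_plevel i j))) => j _.
rewrite /comp.
by case: ifP.
Qed.

Lemma good_countE : good_count = Z.of_nat
  (\sum_(c < 128) \sum_(j' < 32) \sum_(i' < 16) \sum_(i < 32) \sum_(j < 64)
    compatible c j' i' i j)%N.
Proof.
rewrite /good_count cell_levelsE map_mkseq.
apply: (@zsum_mkseq _ (fun c => \sum_(j' < 32) \sum_(i' < 16) \sum_(i < 32) \sum_(j < 64)
    compatible c j' i' i j)%N) => c _.
rewrite /comp map_mkseq.
apply: (@zsum_mkseq _ (fun j' => \sum_(i' < 16) \sum_(i < 32) \sum_(j < 64)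
    compatible c j' i' i j)%N) => j' _.
rewrite /comp map_mkseq.
apply: (@zsum_mkseq _ (fun i' => \sum_(i < 32) \sum_(j < 64)
    compatible c j' i' i j)%N) => i' _.
rewrite /comp.
rewrite /compatible; have := @qcell_ge0 c j' i'; set q := qcell c j' i' => q0.
have [q72|q72] := Z.leb_spec q 72.
  rewrite nth_mkseq; last by lia.
  by rewrite zcountE Z2Nat.id.
(* Beyond level 72 the lookup returns the default 0, in agreement with the cap in [compatible]. *)
rewrite nth_default; last by rewrite size_mkseq; lia.
by rewrite big1// => i _; rewrite big1.
Qed.

End GridCount.

(** * Folding the grid by the symmetries *)

Section FoldedSums.

(** The reflection about the middle of [2 n] cells sends cell [i] to cell [2 n - 1 - i]; the smaller
    index represents both. *)
Definition fold_index (n i : nat) : nat := minn i (n.*2.-1 - i).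

Lemma fold_index_lt n i : (i < n.*2)%N -> (fold_index n i < n)%N.
Proof. by rewrite /fold_index; lia. Qed.

Lemma sum_rev n (F : nat -> nat) : (\sum_(i < n) F (n.-1 - i) = \sum_(i < n) F i)%N.
Proof.
rewrite [RHS](reindex_inj rev_ord_inj)/=; apply: eq_bigr => i _; congr F.
by case: n i => [[]//|n] i; rewrite subSS.
Qed.

Lemma sum_fold_index n (F : nat -> nat) :
  (\sum_(i < n.*2) F (fold_index n i) = 2 * \sum_(i < n) F i)%N.
Proof.
rewrite -addnn big_split_ord/= mul2n -addnn; congr addn.
  by apply: eq_bigr => i _; congr F; rewrite /fold_index; have := ltn_ord i; lia.
rewrite -[RHS]sum_rev; apply: eq_bigr => i _; congr F.
by rewrite /fold_index; have := ltn_ord i; lia.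
Qed.

Lemma sum_shift_mod n t (F : nat -> nat) : (0 < n)%N ->
  (\sum_(i < n) F ((i + t) %% n) = \sum_(i < n) F i)%N.
Proof.
case: n => // n _; elim: t => [|t IH].
  by apply: eq_bigr => i _; rewrite addn0 modn_small.
rewrite -IH big_ord_recr [RHS]big_ord_recl/= addnC; congr addn.
  by rewrite add0n addnS -addSn -modnDml modnn add0n.
by apply: eq_bigr => i _; rewrite addnS -addSn.
Qed.

Lemma sum_shift_mod2 n t (F : nat -> nat) : (0 < n)%N ->
  (\sum_(i < n.*2) F ((i + t) %% n) = 2 * \sum_(i < n) F i)%N.
Proof.
move=> n0; rewrite -addnn big_split_ord/= sum_shift_mod// mul2n -addnn; congr addn.
rewrite -(sum_shift_mod t F n0); apply: eq_bigr => i _.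
by rewrite -addnA modnDl.
Qed.

Lemma sum_swap m n (F : nat -> nat -> nat) :
  (\sum_(i < m) \sum_(j < n) F i j = \sum_(j < n) \sum_(i < m) F i j)%N.
Proof. exact: exchange_big. Qed.

End FoldedSums.

Section GoodCells.

(* [phi'] runs over [0, 2 pi], so it is folded once more than the other angles. *)
Definition phi_index j' := fold_index 64 j'.

(** The cell of [b + alpha] modulo [pi]. Folding exactly one of [theta], [phi] negates [b], and
    folding exactly one of [theta'], [phi'] reflects the resulting cell; [127 - c] rather than
    [128 - c] because a reflected cell has its ends exchanged. *)
Definition beta_index (b a i j i' j' : nat) : nat :=
  let c := ((a + (if (32 <= i)%N (+) (64 <= j)%N then 128 - b else b)) %% 128)%N in
  if (16 <= i')%N (+) (32 <= phi_index j')%N then (127 - c)%N else c.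

Definition good (a i j i' j' : nat) : bool :=
  compatible (beta_index (hint (fold_index 32 i) (fold_index 64 j)) a i j i' j')
     (fold_index 32 (phi_index j')) (fold_index 16 i')
    (fold_index 32 i) (fold_index 64 j).

(** The factor is [64 = 2 * 4 * 2 * 2 * 2]: [alpha] covers two periods, [phi'] is folded twice, and
    [theta'], [phi], [theta] once each. *)
Lemma good_sum :
  (\sum_(a < 256) \sum_(i < 64) \sum_(j < 128) \sum_(i' < 32) \sum_(j' < 128)
    good a i j i' j' =
  64 * \sum_(c < 128) \sum_(j' < 32) \sum_(i' < 16) \sum_(i < 32) \sum_(j < 64)
    compatible c j' i' i j)%N.
Proof.
(* The offset from [hint] is only a cyclic shift of [a], so it disappears in the sum over
   [alpha]. *)
have beta_sum i j i' j' : (\sum_(a < 256) good a i j i' j' =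
    2 * \sum_(c < 128) compatible c (fold_index 32 (phi_index j')) (fold_index 16 i')
      (fold_index 32 i) (fold_index 64 j))%N.
  rewrite /good /beta_index; set b := if _ then (128 - _)%N else _.
  pose F c := nat_of_bool (compatible c (fold_index 32 (phi_index j')) (fold_index 16 i')
      (fold_index 32 i) (fold_index 64 j)).
  set s := (15 < i')%N (+) _; case: s; last exact: (@sum_shift_mod2 128 b F).
  transitivity (2 * \sum_(c < 128) F (127 - c))%N; last by rewrite (@sum_rev 128 F).
  exact: (@sum_shift_mod2 128 b (fun c => F (127 - c)%N)).
pose G i j i' j' := (\sum_(c < 128) compatible c j' i' i j)%N.
have phi_sum i j i' : (\sum_(j' < 128) 2 * G i j i' (fold_index 32 (phi_index j')) =
    8 * \sum_(j' < 32) G i j i' j')%N.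
  rewrite -big_distrr/= (@sum_fold_index 64 (fun k => G i j i' (fold_index 32 k))).
  by rewrite (@sum_fold_index 32 (G i j i')) !mulnA.
have theta_sum i j : (\sum_(i' < 32) \sum_(j' < 128)
    2 * G i j (fold_index 16 i') (fold_index 32 (phi_index j')) =
    16 * \sum_(i' < 16) \sum_(j' < 32) G i j i' j')%N.
  under eq_bigr do rewrite phi_sum.
  by rewrite -big_distrr/= (@sum_fold_index 16 (fun i' => \sum_(j' < 32) G i j i' j')%N) mulnA.
transitivity (\sum_(i < 64) \sum_(j < 128) \sum_(i' < 32) \sum_(j' < 128)
  2 * G (fold_index 32 i) (fold_index 64 j) (fold_index 16 i') (fold_index 32 (phi_index j')))%N.
  rewrite (sum_swap _ _ (fun a i => \sum_(j < 128) \sum_(i' < 32) \sum_(j' < 128)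
    good a i j i' j')%N); apply: eq_bigr => i _.
  rewrite (sum_swap _ _ (fun a j => \sum_(i' < 32) \sum_(j' < 128) good a i j i' j')%N).
  apply: eq_bigr => j _.
  rewrite (sum_swap _ _ (fun a i' => \sum_(j' < 128) good a i j i' j')%N).
  apply: eq_bigr => i' _; rewrite (sum_swap _ _ (fun a j' => good a i j i' j')).
  by apply: eq_bigr => j' _; exact: beta_sum.
under eq_bigr do under eq_bigr do rewrite theta_sum.
under eq_bigr => i _ do rewrite -big_distrr/=
  (@sum_fold_index 64 (fun j => \sum_(i' < 16) \sum_(j' < 32) G (fold_index 32 i) j i' j')%N) mulnA.
rewrite -big_distrr/= (@sum_fold_index 32 (fun i => \sum_(j < 64) \sum_(i' < 16)
  \sum_(j' < 32) G i j i' j')%N) mulnA; congr muln; rewrite /G.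
transitivity (\sum_(i < 32) \sum_(j < 64) \sum_(c < 128) \sum_(j' < 32) \sum_(i' < 16)
   compatible c j' i' i j)%N.
  apply: eq_bigr => i _; apply: eq_bigr => j _.
  transitivity (\sum_(i' < 16) \sum_(c < 128) \sum_(j' < 32) compatible c j' i' i j)%N.
    by apply: eq_bigr => i' _; exact: (sum_swap _ _ (fun j' c => compatible c j' i' i j)).
  rewrite (sum_swap _ _ (fun i' c => \sum_(j' < 32) compatible c j' i' i j)%N).
  by apply: eq_bigr => c _; exact: (sum_swap _ _ (fun i' j' => compatible c j' i' i j)).
transitivity (\sum_(i < 32) \sum_(c < 128) \sum_(j < 64) \sum_(j' < 32) \sum_(i' < 16)
   compatible c j' i' i j)%N.
  apply: eq_bigr => i _.
  exact: (sum_swap _ _ (fun j c => \sum_(j' < 32) \sum_(i' < 16) compatible c j' i' i j)%N).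
rewrite (sum_swap _ _ (fun i c => \sum_(j < 64) \sum_(j' < 32) \sum_(i' < 16)
   compatible c j' i' i j)%N).
apply: eq_bigr => c _.
transitivity (\sum_(i < 32) \sum_(j' < 32) \sum_(i' < 16) \sum_(j < 64) compatible c j' i' i j)%N.
  apply: eq_bigr => i _.
  rewrite (sum_swap _ _ (fun j j' => \sum_(i' < 16) compatible c j' i' i j)%N).
  by apply: eq_bigr => j' _; exact: (sum_swap _ _ (fun j i' => compatible c j' i' i j)).
rewrite (sum_swap _ _ (fun i j' => \sum_(i' < 16) \sum_(j < 64) compatible c j' i' i j)%N).
apply: eq_bigr => j' _.
exact: (sum_swap _ _ (fun i i' => \sum_(j < 64) compatible c j' i' i j)%N).
Qed.

End GoodCells.

(** * Good parameters and their measure *)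

Section GoodPoints.
Variable R : realType.
Local Notation mesh := (mesh R).

(** Half-open, so that distinct cells are disjoint and measures of boxes add up. *)
Definition cell (w : R) (n : nat) : set R := `[n%:R * w, n.+1%:R * w[%classic.

Lemma cellP w n x : cell w n x -> n%:R * w <= x <= n.+1%:R * w.
Proof. by rewrite /cell/= in_itv/= => /andP[-> /ltW->]. Qed.

Lemma fold_cell n (w x : R) i : (i < n.*2)%N -> i%:R * w <= x <= i.+1%:R * w ->
  let y := if (n <= i)%N then n.*2%:R * w - x else x in
  (fold_index n i)%:R * w <= y <= (fold_index n i).+1%:R * w.
Proof.
move=> i2 /andP[l u]; rewrite /fold_index; case: ifP => ni /=.
  have -> : minn i (n.*2.-1 - i) = (n.*2.-1 - i)%N by lia.
  have e : n.*2 = (n.*2.-1 - i + i.+1)%N by lia.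
  have e' : n.*2 = ((n.*2.-1 - i).+1 + i)%N by lia.
  apply/andP; split.
    by rewrite lerBrDl addrC [in leRHS]e natrD mulrDl lerD2l.
  by rewrite lerBlDr [in leLHS]e' natrD mulrDl lerD2l.
have -> : minn i (n.*2.-1 - i) = i by lia.
by rewrite l u.
Qed.

Lemma mesh_pi : 128%:R * mesh = pi.
Proof. by rewrite /mesh mulrC divfK// pnatr_eq0. Qed.

Lemma diam_fold_theta (n : nat) (w t p b : R) i : n.*2%:R * w = pi / 2 ->
  diam t p b = diam (if (n <= i)%N then n.*2%:R * w - t else t) p (if (n <= i)%N then - b else b).
Proof. by move=> ->; case: ifP => // _; rewrite diam_theta opprK. Qed.

Lemma diam_fold_phi (n : nat) (w t p b : R) i : n.*2%:R * w = pi ->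
  diam t p b = diam t (if (n <= i)%N then n.*2%:R * w - p else p) (if (n <= i)%N then - b else b).
Proof. by move=> ->; case: ifP => // _; rewrite diam_phi opprK. Qed.

Lemma diam_fold_phi2 (n : nat) (w t p b : R) i : n.*2%:R * w = pi *+ 2 ->
  diam t p b = diam t (if (n <= i)%N then n.*2%:R * w - p else p) b.
Proof. by move=> ->; case: ifP => // _; rewrite diam_phi2. Qed.

Lemma diamNDnpi (t p b : R) n : diam t p (- (b + n%:R * pi)) = diam t p (- b).
Proof. by rewrite -(diamDnpi t p (- (b + _)) n) opprD subrK. Qed.

Lemma hint_le i j : (hint i j <= 128)%N.
Proof. by rewrite /hint; case: (if _ then _ else _) => x y; exact: geq_minl. Qed.

Lemma beta_index_lt b a i j i' j' : (beta_index b a i j i' j' < 128)%N.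
Proof. by rewrite /beta_index; case: ifP => _; rewrite ?ltn_mod// ltnS leq_subr. Qed.

Lemma folded_no_passage a i j i' j' b (r alpha t p t' p' : R) :
  (i < 64)%N -> (j < 128)%N -> (i' < 32)%N -> (j' < 128)%N -> (b <= 128)%N ->
  1344%:R / 1000%:R <= r ->
  (forall t p, (fold_index 32 i)%:R * mesh <= t <= (fold_index 32 i).+1%:R * mesh ->
    (fold_index 64 j)%:R * mesh <= p <= (fold_index 64 j).+1%:R * mesh ->
    r <= diam t p (b%:R * mesh)) ->
  (forall t p x,
    (fold_index 16 i').*2%:R * mesh <= t <= (fold_index 16 i').+1.*2%:R * mesh ->
    (fold_index 32 (phi_index j')).*2%:R * mesh <= p <=
      (fold_index 32 (phi_index j')).+1.*2%:R * mesh ->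
    (beta_index b a i j i' j')%:R * mesh <= x <= (beta_index b a i j i' j').+1%:R * mesh ->
    diam t p x <= r) ->
  cell mesh a alpha -> cell mesh i t -> cell mesh j p ->
  cell (2 * mesh) i' t' -> cell (2 * mesh) j' p' ->
  ~ rupert_passage (Pa (11%:R / 20%:R)) alpha t p t' p'.
Proof.
move=> hi hj hi' hj' b128 r0 lower; rewrite /beta_index.
set s := (31 < i)%N (+) (63 < j)%N; set s' := (15 < i')%N (+) (31 < phi_index j')%N.
set c0 := (_ %% _)%N; set c := (if s' then _ else _).
move=> upper /cellP al /cellP tt /cellP pp /cellP tt' /cellP pp'.
have m64 : 64%:R * mesh = pi / 2 by rewrite -mesh_pi; field.
have m128 : 128%:R * mesh = pi by exact: mesh_pi.
have m32 : 32%:R * (2 * mesh) = pi / 2 by rewrite -mesh_pi; field.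
have m64' : 64%:R * (2 * mesh) = pi by rewrite -mesh_pi; ring.
have m128' : 128%:R * (2 * mesh) = pi *+ 2 by rewrite -mesh_pi; ring.
(* The direction used for the unfolded first shadow. *)
pose be : R := if s then - (b%:R * mesh) else b%:R * mesh.
have c0lt : (c0 < 128)%N by rewrite /c0 ltn_mod.
have big : r <= diam t p be.
  rewrite (@diam_fold_theta 32 mesh t p be i m64) (@diam_fold_phi 64 mesh _ p _ j m128).
  rewrite (_ : (if (64 <= j)%N then - _ else _) = b%:R * mesh :> R); last first.
    rewrite /be /s; case: (32 <= i)%N (64 <= j)%N => -[]; rewrite /= ?opprK//.
  by apply: lower; apply: fold_cell.
have small : diam t' p' (be + alpha) <= r.
  set g := be + alpha.
  rewrite (@diam_fold_phi2 64 (2 * mesh) t' p' g j' m128').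
  set p1 := if _ then _ else p'.
  have p1P : (phi_index j')%:R * (2 * mesh) <= p1 <= (phi_index j').+1%:R * (2 * mesh).
    exact: fold_cell.
  rewrite (@diam_fold_theta 16 (2 * mesh) t' p1 g i' m32).
  rewrite (@diam_fold_phi 32 (2 * mesh) _ p1 _ (phi_index j') m64').
  rewrite (_ : (if (32 <= phi_index j')%N then - _ else _) = (if s' then - g else g)); last first.
    by rewrite /s'; case: (16 <= i')%N (32 <= phi_index j')%N => -[]; rewrite /= ?opprK.
  pose sb := if s then (128 - b)%N else b.
  (* Modulo [pi], the direction [g] lies in cell [c0]: when [b] is negated, adding [pi] turns it
     into [128 - b] cells, and the quotient by 128 counts the remaining half-turns. *)
  have gP : exists n m : nat, exists2 x, c0%:R * mesh <= x <= c0.+1%:R * mesh &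
      g + n%:R * pi = x + m%:R * pi.
    exists (s : nat), ((a + sb) %/ 128)%N, (g + (s : nat)%:R * pi - ((a + sb) %/ 128)%N%:R * pi);
      last by rewrite subrK.
    have e : (a + sb = (a + sb) %/ 128 * 128 + c0)%N by exact: divn_eq.
    have eR : a%:R * mesh + (be + (s : nat)%:R * pi) = ((a + sb) %/ 128)%N%:R * pi + c0%:R * mesh.
      have -> : be + (s : nat)%:R * pi = sb%:R * mesh.
        rewrite /be /sb; case: (s) => /=; last by rewrite mul0r addr0.
        by rewrite mul1r natrB// -mesh_pi mulrBl addrC.
      rewrite -mulrDl -natrD {1}e natrD natrM mulrDl -mulrA. by rewrite mesh_pi.
    move: al eR; rewrite /g -(addn1 a) -(addn1 c0) (natrD _ a) (natrD _ c0) !mulrDl mul1r.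
    set A := a%:R * mesh; set C := c0%:R * mesh; set S := _ * pi; set K := _ * pi.
    by clear => /andP[l u] e; apply/andP; split; lra.
  case: gP => n [m [x xP gx]].
  have -> : diam (if (16 <= i')%N then 16.*2%:R * (2 * mesh) - t' else t')
     (if (32 <= phi_index j')%N then 32.*2%:R * (2 * mesh) - p1 else p1)
     (if s' then - g else g) =
    diam (if (16 <= i')%N then 16.*2%:R * (2 * mesh) - t' else t')
     (if (32 <= phi_index j')%N then 32.*2%:R * (2 * mesh) - p1 else p1)
     (if s' then pi - x else x).
    case: (s').
      by rewrite -(diamNDnpi _ _ g n) gx diamNDnpi [pi - x]addrC diamDpi.
    by rewrite -(diamDnpi _ _ g n) gx diamDnpi.
  have dbl n' (y : R) : n'%:R * (2 * mesh) <= y <= n'.+1%:R * (2 * mesh) ->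
      n'.*2%:R * mesh <= y <= n'.+1.*2%:R * mesh.
    by rewrite -!mul2n !natrM !mulrA [n'%:R * 2]mulrC [n'.+1%:R * 2]mulrC.
  apply: upper.
  - by apply: dbl; apply: fold_cell.
  - by apply: dbl; apply: fold_cell => //; exact: fold_index_lt.
  - rewrite /c; case: (s') => //.
    (* [pi - x] lies in the cell [127 - c0], its ends being the reflected ends of [c0] in reverse
       order. *)
    have -> : (127 - c0).+1 = (128 - c0)%N by rewrite -subSn.
    have -> : (127 - c0)%:R * mesh = pi - c0.+1%:R * mesh.
      by rewrite -mesh_pi -mulrBl -natrB// subSS.
    have -> : (128 - c0)%N%:R * mesh = pi - c0%:R * mesh.
      by rewrite -mesh_pi -mulrBl -natrB// ltnW.
    by case/andP: xP => l u; rewrite !lerD2l !lerN2 u l.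
move: big small => /diam_geP[e ee er] /diam_leP small.
exact: no_passage (r0) ee er small.
Qed.

Lemma good_no_passage a i j i' j' (alpha t p t' p' : R) :
  (i < 64)%N -> (j < 128)%N -> (i' < 32)%N -> (j' < 128)%N ->
  good a i j i' j' ->
  cell mesh a alpha -> cell mesh i t -> cell mesh j p ->
  cell (2 * mesh) i' t' -> cell (2 * mesh) j' p' ->
  ~ rupert_passage (Pa (11%:R / 20%:R)) alpha t p t' p'.
Proof.
move=> hi hj hi' hj'; rewrite /good /compatible /best_plevel.
have := hint_le (fold_index 32 i) (fold_index 64 j).
move: (hint _ _) => b b128.
have : (beta_index b a i j i' j' < 128)%N by exact: beta_index_lt.
set c := beta_index _ _ _ _ _ _ => c128.
have := @qcell_ge0 c (fold_index 32 (phi_index j')) (fold_index 16 i').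
have := @qcell_upper R c (fold_index 32 (phi_index j')) (fold_index 16 i').
move: (qcell _ _ _) => q up q0 /andP[/Z.leb_le q72 /Z.leb_le qp].
apply: (@folded_no_passage a i j i' j' b (level_value R q)) => //.
- exact: level_value_ge.
- move=> x y; apply: (pcell_lower b128 _ _ q0 qp).
  + by apply: leq_trans (fold_index_lt _) _.
  + by apply: leq_trans (fold_index_lt _) _.
- move=> x y z; apply: up => //; last exact: fold_index_lt.
  exact: fold_index_lt (fold_index_lt _).
Qed.

End GoodPoints.

(** * Measure of the union of the good boxes *)

Section GoodSet.
Variable R : realType.
Local Notation mesh := (mesh R).
Local Notation leb := (@lebesgue_measure R).

Definition grid_index : finType := ('I_256 * 'I_64 * 'I_128 * 'I_32 * 'I_128)%type.

Definition good_index (k : grid_index) : bool :=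
  let: (a, i, j, i', j') := k in good a i j i' j'.

Definition box (k : grid_index) : set (R * R * R * R * R) :=
  let: (a, i, j, i', j') := k in
  cell mesh a `*` cell mesh i `*` cell mesh j `*` cell (2 * mesh) i' `*` cell (2 * mesh) j'.

Definition good_set : set (R * R * R * R * R) := \bigcup_(k in [set k | good_index k]) box k.

Lemma leb5_setX (A1 A2 A3 A4 A5 : set R) : measurable A1 -> measurable A2 ->
  measurable A3 -> measurable A4 -> measurable A5 ->
  leb5 (A1 `*` A2 `*` A3 `*` A4 `*` A5) =
  (leb A1 * leb A2 * leb A3 * leb A4 * leb A5)%E.
Proof.
move=> m1 m2 m3 m4 m5.
have m12 := measurableX m1 m2; have m13 := measurableX m12 m3.
have m14 := measurableX m13 m4.
have e2 := @product_measure1E _ _ _ _ R leb leb _ _ m1 m2.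
have e3 := @product_measure1E _ _ _ _ R (leb \x leb)%E leb _ _ m12 m3.
have e4 := @product_measure1E _ _ _ _ R (leb \x leb \x leb)%E leb _ _ m13 m4.
have e5 := @product_measure1E _ _ _ _ R (leb \x leb \x leb \x leb)%E leb _ _ m14 m5.
apply: etrans; first exact: e5.
congr (_ * _)%E; apply: etrans; first exact: e4.
congr (_ * _)%E; apply: etrans; first exact: e3.
by congr (_ * _)%E; exact: e2.
Qed.

Lemma measurable_cell (w : R) n : measurable (cell w n).
Proof. exact: measurable_itv. Qed.

Lemma measurable_box k : measurable (box k).
Proof.
case: k => [[[[a i] j] i'] j'].
by do !apply: measurableX; exact: measurable_cell.
Qed.

Lemma leb_cell (w : R) n : 0 < w -> leb (cell w n) = w%:E.
Proof.
move=> w0; rewrite /cell lebesgue_measure_itv/= lte_fin ltr_pM2r// ltr_nat ltnSn.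
by rewrite -EFinB -mulrBl -addn1 natrD addrAC subrr add0r mul1r.
Qed.

Lemma leb5_box k : leb5 (box k) = (4%:R * mesh ^+ 5)%:E.
Proof.
have m0 := mesh_gt0 R; have m20 : 0 < 2 * mesh by rewrite mulr_gt0.
case: k => [[[[a i] j] i'] j']; rewrite /box leb5_setX; do ?exact: measurable_cell.
by rewrite !leb_cell// -!EFinM; congr EFin; ring.
Qed.

Lemma cell_inj (w : R) n n' x : 0 < w -> cell w n x -> cell w n' x -> n = n'.
Proof.
move=> w0; rewrite /cell/= !in_itv/= => /andP[l u] /andP[l' u'].
have := le_lt_trans l u'; have := le_lt_trans l' u.
by rewrite !ltr_pM2r// !ltr_nat => h1 h2; lia.
Qed.

Lemma trivIset_box (D : set grid_index) : trivIset D box.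
Proof.
have m0 := mesh_gt0 R; have m20 : 0 < 2 * mesh by rewrite mulr_gt0.
move=> [[[[a i] j] i'] j'] [[[[b k] l] k'] l'] _ _ [[[[[x y] z] t] s]].
move=> [[[[[/= h1 h2] h3] h4] h5] [[[[/= g1 g2] g3] g4] g5]].
have e1 := ord_inj (cell_inj m0 h1 g1); have e2 := ord_inj (cell_inj m0 h2 g2).
have e3 := ord_inj (cell_inj m0 h3 g3); have e4 := ord_inj (cell_inj m20 h4 g4).
have e5 := ord_inj (cell_inj m20 h5 g5).
by rewrite e1 e2 e3 e4 e5.
Qed.

Lemma measurable_good_set : measurable good_set.
Proof. by apply: fin_bigcup_measurable => // k _; exact: measurable_box. Qed.

Lemma leb5_good_set :
  leb5 good_set = ((\sum_(k : grid_index) good_index k)%N%:R * (4%:R * mesh ^+ 5))%:E.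
Proof.
rewrite /good_set /leb5 measure_fin_bigcup; last 3 first.
- exact: finite_finset.
- exact: trivIset_box.
- by move=> k _; exact: measurable_box.
rewrite (eq_fsbigr (fun=> (4%:R * mesh ^+ 5)%:E)); last by move=> k _; exact: leb5_box.
have -> : [set k | good_index k] = [set` [seq k <- index_enum grid_index | good_index k]].
  by apply/seteqP; split=> k /=; rewrite mem_filter mem_index_enum andbT.
rewrite -fsbig_seq ?filter_uniq ?index_enum_uniq// big_filter sumEFin; congr EFin.
rewrite natr_sum mulr_suml big_mkcond; apply: eq_bigr => k _.
by case: (good_index k); rewrite ?mul1r ?mul0r.
Qed.

Lemma sum_good_index :
  (\sum_(k : grid_index) good_index k = \sum_(a < 256) \sum_(i < 64) \sum_(j < 128)
     \sum_(i' < 32) \sum_(j' < 128) good a i j i' j')%N.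
Proof.
by rewrite !pair_bigA/=; apply: eq_bigr => -[[[[a i] j] i'] j'].
Qed.

Lemma cell_bound (w : R) n N x : 0 < w -> (n < N)%N -> cell w n x -> 0 <= x <= N%:R * w.
Proof.
move=> w0 nN /cellP/andP[l u]; apply/andP; split.
  by apply: le_trans l; rewrite mulr_ge0// ltW.
by apply: le_trans u _; rewrite ler_pM2r// ler_nat.
Qed.

Lemma good_set_sub : good_set `<=` @Lambda R.
Proof.
have m0 := mesh_gt0 R; have m20 : 0 < 2 * mesh by rewrite mulr_gt0.
move=> [[[[x y] z] t] s] [[[[[a i] j] i'] j'] _] [[[[/= h1 h2] h3] h4] h5].
have := cell_bound m0 (ltn_ord a) h1; have := cell_bound m0 (ltn_ord i) h2.
have := cell_bound m0 (ltn_ord j) h3; have := cell_bound m20 (ltn_ord i') h4.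
have := cell_bound m20 (ltn_ord j') h5.
have -> : 256%:R * mesh = 2 * pi by rewrite -mesh_pi; ring.
have -> : 64%:R * mesh = pi / 2 by rewrite -mesh_pi; field.
have -> : 128%:R * (2 * mesh) = 2 * pi by rewrite -mesh_pi; ring.
have -> : 32%:R * (2 * mesh) = pi / 2 by rewrite -mesh_pi; field.
by rewrite mesh_pi => *; split.
Qed.

Lemma leb_Lambda : leb5 (@Lambda R) = (pi ^+ 5)%:E.
Proof.
have -> : @Lambda R = `[0, 2 * pi] `*` `[0, pi / 2] `*` `[0, pi] `*` `[0, pi / 2] `*` `[0, 2 * pi].
  apply/seteqP; split=> -[[[[x y] z] t] s]; rewrite /Lambda/=.
    by move=> [h1 h2 h3 h4 h5]; rewrite !in_itv/=.
  by move=> [[[[]]]]; rewrite !in_itv/= => *; split.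
have p0 := @pi_gt0 R.
rewrite leb5_setX; do ?exact: measurable_itv.
rewrite !lebesgue_measure_itv/= !lte_fin p0 !mulr_gt0// -!EFinB !subr0 -!EFinM.
by congr EFin; field.
Qed.

End GoodSet.

Theorem mainTheorem1 (R : realType) :
  exists E : set (R * R * R * R * R),
    [/\ measurable E, E `<=` @Lambda R,
        ((88%:R / 100%:R : R)%:E * @leb5 R (@Lambda R) <= @leb5 R E)%E &
        forall alpha theta phi theta' phi',
          E (alpha, theta, phi, theta', phi') ->
          ~ rupert_passage (Pa (11%:R / 20%:R)) alpha theta phi theta' phi'].
Proof.
exists (@good_set R); split; [exact: measurable_good_set|exact: good_set_sub| |].
- rewrite leb_Lambda leb5_good_set -EFinM lee_fin sum_good_index good_sum natrM.
  set n := (\sum_(c < 128) _)%N.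
  have /Z.leb_le/(zr_le R) := good_count_ge.
  rewrite good_countE -/n (zrM R 100) zr_nat (zrM R 88) (zr_nat R 100) (zr_nat R 88).
  have -> : Z.div S40 (Z.pow 2 13) = Z.pow 2 (Z.of_nat 27) by [].
  rewrite zr_pow2 => le_n.
  have -> : pi = 2 ^+ 7 * mesh R by rewrite -natrX mesh_pi.
  have m5 : 0 < mesh R ^+ 5 by rewrite exprn_gt0// mesh_gt0.
  rewrite exprMn -exprM [leLHS]mulrA [leRHS]mulrA ler_pM2r//.
  (* In units of [mesh ^ 5] the whole domain measures [2 ^ 35], and the good set [64 * 4 = 2 ^ 8]
     times the number of good pairs out of [2 ^ 27]. *)
  have e : 2 ^+ (7 * 5) = 2 ^+ 8 * 2 ^+ 27 :> R by rewrite -exprD.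
  rewrite e; move: le_n; set x := _ ^+ 27; set y := n%:R; clear.
  have -> : 2 ^+ 8 = 256%:R :> R by rewrite -natrX.
  lra.
- move=> alpha theta phi theta' phi' [[[[[a i] j] i'] j'] /= gk].
  move=> [[[[/= h1 h2] h3] h4] h5].
  exact: (good_no_passage (ltn_ord i) (ltn_ord j) (ltn_ord i') (ltn_ord j') gk h1 h2 h3 h4 h5).
Qed.
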